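(* Let $T\ge1$, $\lambda_t>0$, $\alpha_t>0$ for $1\le t\le T$, and let $\mathbf C=(C_{st})$ be a positive definite $T\times T$ matrix with unit diagonal. In the unsupervised multitask Gaussian mixture problem ($\eta_t=0$ for all $t$) with signal-to-noise ratios $\lambda_t=1/\sigma_t^2$, sampling ratios $\alpha_t$ and task-correlation matrix $\mathbf C$, with overlaps as defined in the context, the classification is impossible (that is, $q_{ut}=0$ for all $t$) if and only if all eigenvalues of the symmetric positive semidefinite matrix $$\mathbf R=\big(\sqrt{\alpha_s\alpha_t}\,\lambda_s\lambda_tC_{st}^2\big)_{s,t=1}^T$$ are not greater than $1$.
   Context: Overlaps in the unsupervised case. Let $\sigma_t=\lambda_t^{-1/2}$, $\mathbf M=\big(C_{tt'}/(\sigma_t\sigma_{t'})\big)_{t,t'=1}^T$ and $F(q)=\mathbb E[\tanh(\sqrt q\,Z+q)]$ for $q\ge0$, with $Z\sim\mathcal N(0,1)$. The overlaps $(q_{ut},q_{vt})_{t=1}^T$ (nonnegative numbers) are the stable solution of the fixed-point equations $$q_{ut}=\big[\mathbf M-\mathbf M(\mathbf I+\mathbf D\mathbf M)^{-1}\big]_{tt},\qquad q_{vt}=F(q_{ut}),\qquad 1\le t\le T,$$ where $\mathbf D=\operatorname{diag}(\alpha_tq_{vt})_{t=1}^T$. Here a solution is called stable if it is a (Lyapunov) stable fixed point, on $[0,\infty)^T$, of the iteration $\mathbf q_u\mapsto G(\mathbf q_u)$, $G_t(\mathbf q_u)=[\mathbf M-\mathbf M(\mathbf I+\mathbf D\mathbf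 M)^{-1}]_{tt}$ with $\mathbf D=\operatorname{diag}(\alpha_sF(q_{us}))_{s=1}^T$. The vector $(\mathbf 0,\mathbf 0)$ is always a solution; when there are several solutions the overlaps are, by convention, the stable one. Classification of task $t$ is called impossible if $q_{ut}=0$ and feasible if $q_{ut}>0$. *)

(* Defs.v *)
From HB Require Import structures.
From mathcomp Require Import all_boot all_order all_algebra.
From mathcomp Require Import all_classical all_reals all_analysis.

Set Implicit Arguments.
Unset Strict Implicit.
Unset Printing Implicit Defensive.

Import Order.TTheory GRing.Theory Num.Theory.
Import numFieldNormedType.Exports.

Local Open Scope classical_set_scope.
Local Open Scope ring_scope.

Definition tanh (R : realType) (x : R) : R :=
  (expR x - expR (- x)) / (expR x + expR (- x)).

Definition posdefmx (R : realType) (n : nat) (A : 'M[R]_n) : Prop :=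
  A^T = A /\ forall x : 'rV[R]_n, x != 0 -> 0 < (x *m A *m x^T) 0 0.

(* Lyapunov stability of a fixed point p of f : X -> X.  The points p + d are
   restricted to X; f is a total function whose values off X are irrelevant. *)
Definition lyapunov_stable (R : realType) (V : normedModType R)
    (X : set V) (f : V -> V) (p : V) : Prop :=
  forall e : R, 0 < e -> exists2 d : R, 0 < d &
    forall x : V, X x -> `|x - p| < d ->
      forall n : nat, `|iter n f x - p| < e.

Definition orthant (R : realType) (n : nat) : set 'rV[R]_n :=
  [set q | forall t, 0 <= q 0 t].

Section overlaps.
Context (R : realType) (T : nat).
Implicit Types (alpha lambda : 'I_T -> R) (C : 'M[R]_T) (q : 'rV[R]_T).

(* F(q) = E[tanh(sqrt q Z + q)], Z ~ N(0,1).  The integrand is bounded and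
   measurable, so the expectation is finite and [fine] loses nothing. *)
Definition Foverlap (q : R) : R :=
  fine ('E_(normal_prob 0 1)[fun z : R => tanh (Num.sqrt q * z + q)]).

Definition noise_sd lambda (t : 'I_T) : R := (Num.sqrt (lambda t))^-1.

Definition Mmx lambda C : 'M[R]_T :=
  \matrix_(s, t) (C s t / (noise_sd lambda s * noise_sd lambda t)).

Definition Dmx alpha (qv : 'rV[R]_T) : 'M[R]_T :=
  diag_mx (\row_t (alpha t * qv 0 t)).

(* For C positive definite and qv >= 0, the matrix I + D M is invertible
   (D M has the nonnegative eigenvalues of D^1/2 M D^1/2), so that [invmx] is
   the genuine inverse. *)
Definition qu_of alpha lambda C (qv : 'rV[R]_T) : 'rV[R]_T :=
  let M := Mmx lambda C in
  \row_t (M - M *m invmx (1%:M + Dmx alpha qv *m M)) t t.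

Definition qv_of (qu : 'rV[R]_T) : 'rV[R]_T := \row_t Foverlap (qu 0 t).

Definition Gmap alpha lambda C (qu : 'rV[R]_T) : 'rV[R]_T :=
  qu_of alpha lambda C (qv_of qu).

(* The pair q = (q_u, q_v) is a stable solution of the fixed-point equations. *)
Definition is_overlaps alpha lambda C (q : 'rV[R]_T * 'rV[R]_T) : Prop :=
  [/\ orthant q.1 /\ orthant q.2,
      q.1 = qu_of alpha lambda C q.2,
      q.2 = qv_of q.1 &
      lyapunov_stable (@orthant R T) (Gmap alpha lambda C) q.1].

Definition impossible (q : 'rV[R]_T * 'rV[R]_T) (t : 'I_T) : Prop :=
  q.1 0 t = 0.

Definition Rmx alpha lambda C : 'M[R]_T :=
  \matrix_(s, t)
    (Num.sqrt (alpha s * alpha t) * lambda s * lambda t * C s t ^+ 2).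

End overlaps.

(* Main.v *)
Require Import Defs.
From HB Require Import structures.
From mathcomp Require Import all_boot all_order all_algebra.
From mathcomp Require Import all_classical all_reals all_analysis.
From mathcomp Require Import measurable_realfun.
From mathcomp Require Import ring lra.

Set Implicit Arguments.
Unset Strict Implicit.
Unset Printing Implicit Defensive.

Import Order.TTheory GRing.Theory Num.Theory.
Import numFieldNormedType.Exports.

Local Open Scope ring_scope.

(** Reweighting the Gaussian density gives
    F q = 1 - exp (- q / 2) E [1 / cosh (sqrt q Z)].  From this form F is
    increasing, subhomogeneous (c F q <= F (c q) for 0 <= c <= 1, because
    y |-> 1 / cosh (sqrt y) is convex), satisfies F q < q for q > 0, and
    F q = q - O(q^2).  The t-th diagonal entry of M - M (I + D M)^-1 is the
    minimum over y of (e_t - y)^T M (e_t - y) + (M y)^T D (M y), which is affine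
    in D, so it is monotone and subhomogeneous in D and lies just below its
    linearization (M D M)_tt.

    Hence G is monotone, strictly subhomogeneous and bounded.  Its greatest
    fixed point q is stable: the iterates of G from the top are supersolutions
    strictly above q and tend to q, and (1 - h) q is a subsolution.  If p is
    another fixed point then p <= q, and iterating from p + d q climbs past every
    c q with c < 1, so p is unstable unless p = q.

    The linearization of G at 0 is conjugate to R.  An eigenvector v of R with
    eigenvalue a > 1 yields the subsolution d |v| / sqrt alpha, so q <> 0.  If
    all eigenvalues are at most 1, then w R w^T <= w w^T for all w, whereas a
    nonzero q would give w = sqrt alpha q with w w^T < w R w^T. *)

(** * The overlap function F *)

Section normal_integrals.
Context {R : realType}.
Implicit Types (m s x : R) (f : R -> R).
Local Notation mu := (@lebesgue_measure R).

(** The Radon-Nikodym derivative of the normal law equals [normal_pdf] almost everywhere, since both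
    have the same integral over every measurable set. *)
Lemma ge0_integral_normal_prob m s f : measurable_fun [set: R] f ->
  (forall x, 0 <= f x) ->
  (\int[normal_prob m s]_x (f x)%:E =
   \int[mu]_x (f x * normal_pdf m s x)%:E)%E.
Proof.
move=> mf f0.
have dom := @normal_prob_dominates R m s.
pose g : measurableTypeR R -> \bar R := EFin \o f.
have mg : measurable_fun setT g by exact/measurable_EFinP.
have g0 x : (0 <= g x)%E by rewrite lee_fin.
rewrite -(Radon_Nikodym_SigmaFinite.change_of_variables dom g0 measurableT mg).
have iRN := Radon_Nikodym_SigmaFinite.f_integrable dom.
under [RHS]eq_integral do rewrite EFinM.
have mpdf : measurable_fun setT (fun x : measurableTypeR R => (normal_pdf m s x)%:E).
  by apply/measurable_EFinP; exact: measurable_normal_pdf.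
apply: ae_eq_integral => //.
- by apply: emeasurable_funM => //; exact: measurable_int iRN.
- exact: emeasurable_funM.
- apply: ae_eqe_mul2l; apply: integral_ae_eq => // E _ mE.
  by rewrite -Radon_Nikodym_SigmaFinite.f_integral.
Qed.

Lemma normal_pdf_shift (m x : R) :
  normal_pdf m 1 x = normal_pdf 0 1 (x - m).
Proof.
by rewrite !normal_pdfE ?oner_eq0// normal_fun_center /= /normal_fun !subr0.
Qed.

(** Exponential tilting, by completing the square: t x - x^2/2 = t^2/2 - (x - t)^2/2. *)
Lemma normal_pdf_expR (t x : R) :
  expR (t * x) * normal_pdf 0 1 x = expR (t ^+ 2 / 2) * normal_pdf t 1 x.
Proof.
rewrite !normal_pdfE ?oner_eq0// /normal_fun subr0 !(mulrCA (expR _)).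
rewrite -!expRD; congr (_ * expR _); rewrite expr1n.
by field.
Qed.

Lemma ge0_integral_normal_shift (m : R) (f : R -> R) : continuous f ->
  (forall x, 0 <= f x) ->
  (\int[normal_prob 0 1]_x (f (x + m))%:E = \int[normal_prob m 1]_x (f x)%:E)%E.
Proof.
move=> cf f0.
have mf : measurable_fun [set: R] f by exact: continuous_measurable_fun.
have mfD : measurable_fun [set: R] (fun x => f (x + m)).
  by apply: measurableT_comp => //; exact: measurable_funD.
rewrite (ge0_integral_normal_prob 0 1 mfD) => [|x]; last exact: f0.
rewrite (ge0_integral_normal_prob m 1 mf f0).
pose F (x : R^o) : R^o := x + m.
have dF : F^`()%classic = cst 1.
  by apply/funext => x; rewrite derive1E deriveD// derive_id derive_cst addr0.
rewrite [RHS](@increasing_ge0_integration_by_substitutionT R F).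
- apply: eq_integral => x _; rewrite dF; congr EFin.
  rewrite !fctE mulr1 (normal_pdf_shift m) /F. by rewrite addrK.
- by move=> x y xy; rewrite ltrD2r.
- by rewrite dF => ?; exact: cvg_cst.
- by rewrite dF; exact: is_cvg_cst.
- by rewrite dF; exact: is_cvg_cst.
- by move=> x; apply: derivableD.
- exact: cvg_addrr_Ny.
- exact: cvg_addrr.
- by move=> x; apply: cvgM; [exact: cf|exact: continuous_normal_pdf].
- by move=> x; rewrite mulr_ge0// normal_pdf_ge0.
Qed.

Lemma integral_normal_expR (t : R) :
  (\int[normal_prob 0 1]_x (expR (t * x))%:E = (expR (t ^+ 2 / 2))%:E)%E.
Proof.
rewrite ge0_integral_normal_prob; last by move=> x; exact: expR_ge0.
  under eq_integral do rewrite normal_pdf_expR EFinM.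
  rewrite ge0_integralZl//= ?integral_normal_pdf ?mule1 ?lee_fin ?expR_ge0//.
    by apply/measurable_EFinP; exact: measurable_normal_pdf.
  by move=> x _; rewrite lee_fin normal_pdf_ge0.
by apply: measurableT_comp => //; exact: measurable_funM.
Qed.

End normal_integrals.

(** * Inequalities for cosh and tanh *)

Definition cosh (R : realType) (x : R) : R := (expR x + expR (- x)) / 2.

Section hyperbolic.
Context {R : realType}.
Implicit Types x y k : R.

Lemma cosh_ge1 x : 1 <= cosh x.
Proof.
rewrite /cosh ler_pdivlMr// mul1r.
by have := expR_ge1Dx x; have := expR_ge1Dx (- x); lra.
Qed.

Lemma cosh_gt0 x : 0 < cosh x.
Proof. exact: lt_le_trans (cosh_ge1 x). Qed.

Lemma cosh0 : cosh (0 : R) = 1.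
Proof. by rewrite /cosh oppr0 expR0; lra. Qed.

Lemma coshN x : cosh (- x) = cosh x.
Proof. by rewrite /cosh opprK addrC. Qed.

Lemma cosh_norm x : cosh `|x| = cosh x.
Proof. by have [_|_] := ger0P x; rewrite ?coshN. Qed.

Lemma ler_cosh x y : `|x| <= `|y| -> cosh x <= cosh y.
Proof.
rewrite -(cosh_norm x) -(cosh_norm y).
move: (normr_ge0 x) (normr_ge0 y); move: `|x| `|y| => {}x {}y x0 y0 xy.
rewrite /cosh ler_pM2r ?invr_gt0// !expRN.
have ex : 1 <= expR x by rewrite -expR0 ler_expR.
have exy : expR x <= expR y by rewrite ler_expR.
rewrite -subr_ge0.
have -> : expR y + (expR y)^-1 - (expR x + (expR x)^-1) =
  (expR y - expR x) * (1 - (expR x * expR y)^-1).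
  by field; rewrite !gt_eqF ?expR_gt0.
rewrite mulr_ge0 ?subr_ge0// invf_le1 ?mulr_gt0 ?expR_gt0//.
by apply: mulr_ege1 => //; exact: le_trans exy.
Qed.

Lemma coshMM x : cosh x ^+ 2 = (cosh (2 * x) + 1) / 2.
Proof.
rewrite /cosh -mulrN !(mulrC 2) !expRM_natr expRN.
by field; rewrite gt_eqF ?expR_gt0.
Qed.

(** This half-angle form turns the bound on 1 / cosh in [coshV_star] into one on tanh. *)
Lemma cosh_halfV x :
  1 - (cosh x)^-1 = 2 * tanh (x / 2) ^+ 2 / (1 + tanh (x / 2) ^+ 2).
Proof.
have -> : cosh x = (expR (x / 2) ^+ 2 + expR (- (x / 2)) ^+ 2) / 2.
  by rewrite -!expRM_natr mulNr divfK.
rewrite /tanh expRN; set u := expR _.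
have u0 : 0 < u by exact: expR_gt0.
have u2 : 0 < u ^+ 2 by exact: exprn_gt0.
have u4 : 0 < u ^+ 2 * u ^+ 2 by exact: mulr_gt0.
field; rewrite !andbA -!andbA; apply/and4P; split; apply: lt0r_neq0; nra.
Qed.

Lemma continuous_cosh : continuous (@cosh R).
Proof.
move=> x; apply: cvgM; last exact: cvg_cst.
apply: cvgD; first exact: continuous_expR.
by apply: continuous_comp; [exact: opp_continuous|exact: continuous_expR].
Qed.

Lemma tanhE x : tanh x = 1 - expR (- x) / cosh x.
Proof.
rewrite /tanh /cosh !expRN; have := expR_gt0 x; set u := expR x => u0.
field; apply/andP; split; apply: lt0r_neq0 => //.
by rewrite addr_gt0// ?mulr_gt0.
Qed.

Lemma continuous_tanh : continuous (@tanh R).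
Proof.
have -> : @tanh R = (fun x => 1 - expR (- x) / cosh x).
  by apply/funext => x; rewrite tanhE.
move=> x; apply: cvgB; first exact: cvg_cst.
apply: cvgM.
  by apply: continuous_comp; [exact: opp_continuous|exact: continuous_expR].
apply: cvgV; first exact: lt0r_neq0 (cosh_gt0 x).
exact: continuous_cosh.
Qed.

Lemma tanh_le1 x : tanh x <= 1.
Proof. by rewrite tanhE gerBl divr_ge0 ?expR_ge0// ltW// cosh_gt0. Qed.

Lemma tanh_ge0 x : 0 <= x -> 0 <= tanh x.
Proof.
move=> x0; rewrite /tanh divr_ge0 ?[_ <= _ + expR _]addr_ge0 ?expR_ge0//.
by rewrite subr_ge0 ler_expR ge0_cp.
Qed.

Lemma ler_tanh x y : x <= y -> tanh x <= tanh y.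
Proof.
move=> xy; rewrite /tanh !expRN.
have := expR_gt0 x; have : expR x <= expR y by rewrite ler_expR.
move: (expR x) (expR y) => u v uv u0; have v0 : 0 < v by exact: lt_le_trans uv.
have E (w : R) : 0 < w -> (w - w^-1) / (w + w^-1) = 1 - 2 / (w ^+ 2 + 1).
  move=> w0; field; rewrite !lt0r_neq0 ?addr_gt0 ?mulr_gt0//.
rewrite !E// lerB// ler_pM2l// lef_pV2 ?posrE ?addr_gt0 ?exprn_gt0//.
by rewrite lerD2r ler_pXn2r ?uv // nnegrE ltW.
Qed.

(* sinh x / x is nondecreasing; compared at (1 - k) y <= (1 + k) y. *)
Lemma sinh_star (k y : R) : 0 <= k <= 1 -> 0 <= y ->
  (1 + k) * (expR ((1 - k) * y) - expR (- ((1 - k) * y))) <=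
  (1 - k) * (expR ((1 + k) * y) - expR (- ((1 + k) * y))).
Proof.
move=> /andP[k0 k1] y0.
(* [g] is the difference of the two sides. It vanishes at 0, and its derivative [dg] is nonnegative
   because 1 - k <= 1 + k. *)
pose g := (fun y : R => (1 - k) * expR ((1 + k) * y)
  - (1 - k) * expR (- (1 + k) * y)
  - (1 + k) * expR ((1 - k) * y) + (1 + k) * expR (- (1 - k) * y)).
pose dg := (fun y : R => 2 * (1 - k) * (1 + k) *
   (cosh ((1 + k) * y) - cosh ((1 - k) * y))).
have dE (a x : R) : is_derive x 1 (fun y : R => expR (a * y)) (a * expR (a * x)).
  have -> : a * expR (a * x) = expR (a * x) * (a *: 1).
    by rewrite mulrC; congr (_ * _); rewrite [RHS]mulr1.
  by apply: (@is_derive1_comp R expR (fun y => a * y)).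
have dg' (x : R) : is_derive x 1 g (dg x).
  have -> : dg x = (1 - k) *: ((1 + k) * expR ((1 + k) * x))
    - (1 - k) *: ((- (1 + k)) * expR (- (1 + k) * x))
    - (1 + k) *: ((1 - k) * expR ((1 - k) * x))
    + (1 + k) *: ((- (1 - k)) * expR (- (1 - k) * x)).
    by rewrite /dg /cosh !mulNr /GRing.scale/=; field.
  exact: is_deriveD.
have gc : {within `[0, y], continuous g}%classic.
  apply: derivable_within_continuous => x _.
  by have [] := dg' x.
have [c] := MVT_segment y0 (fun x _ => dg' x) gc.
rewrite in_itv/= => /andP[c0 _].
have -> : g 0 = 0 by rewrite /g !mulr0 expR0; lra.
rewrite /g !mulNr => E.
suff : 0 <= dg c * (y - 0) by rewrite -E; lra.
rewrite mulr_ge0 ?subr0// /dg mulr_ge0 ?mulr_ge0 ?subr_ge0//; first lra.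
by apply: ler_cosh; rewrite !ger0_norm ?mulr_ge0//; nra.
Qed.

(** Over a common denominator, with u = exp (k y) and v = exp y, the difference is a positive
    multiple of (1 - k) sinh ((1 + k) y) - (1 + k) sinh ((1 - k) y), so [sinh_star] applies. *)
Lemma tanhM_ge k y : 0 <= k <= 1 -> 0 <= y -> k * tanh y <= tanh (k * y).
Proof.
move=> k01 y0; have := sinh_star k01 y0; rewrite /tanh.
rewrite (mulrBl y 1) (mulrDl 1 k y) mul1r opprB opprD !expRD !expRN.
have := expR_gt0 (k * y); have := expR_gt0 y.
move: (expR (k * y)) (expR y) => u v v0 u0 H.
rewrite -subr_ge0.
have -> : (u - u^-1) / (u + u^-1) - k * ((v - v^-1) / (v + v^-1)) =
  ((1 - k) * (v * u - v^-1 * u^-1) - (1 + k) * (v * u^-1 - u * v^-1))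
  * (u * v) / ((u ^+ 2 + 1) * (v ^+ 2 + 1)).
  by field; rewrite !lt0r_neq0 ?addr_gt0 ?mulr_gt0.
apply: divr_ge0; last by rewrite mulr_ge0// addr_ge0 ?sqr_ge0.
by apply: mulr_ge0; rewrite ?subr_ge0// mulr_ge0 ?ltW.
Qed.

(* This is the convexity of y |-> 1 / cosh (sqrt y), tested against 0. *)
Lemma coshV_star k x : 0 <= k <= 1 ->
  (cosh (k * x))^-1 <= 1 - k ^+ 2 + k ^+ 2 * (cosh x)^-1.
Proof.
move=> /[dup] k01 /andP[k0 k1].
wlog x0 : x / 0 <= x.
  move=> H; have [/H//|x0] := leP 0 x.
  by rewrite -coshN -(coshN x) -mulrN; apply: H; rewrite oppr_ge0 ltW.
suff : k ^+ 2 * (1 - (cosh x)^-1) <= 1 - (cosh (k * x))^-1 by lra.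
(* With t = tanh y and s = tanh (k y), the claim becomes k^2 t^2 / (1 + t^2) <= s^2 / (1 + s^2), a
   consequence of k t <= s <= t. *)
rewrite !cosh_halfV -(mulrA k).
set y := x / 2; have y0 : 0 <= y by rewrite divr_ge0.
have := tanhM_ge k01 y0.
have : tanh (k * y) <= tanh y by apply: ler_tanh; nra.
have := tanh_ge0 y0; have : 0 <= k * tanh y by rewrite mulr_ge0 ?tanh_ge0.
move: (tanh y) (tanh (k * y)) => t s kt0 t0 st ts.
have s0 : 0 <= s by exact: le_trans ts.
have ss : (k * t) ^+ 2 <= s ^+ 2 by rewrite ler_pXn2r ?nnegrE.
have sst : s ^+ 2 <= t ^+ 2 by rewrite ler_pXn2r ?nnegrE.
have p r : 0 < 1 + r ^+ 2 :> R by rewrite ltr_wpDr ?sqr_ge0.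
rewrite ler_pdivlMr// -mulrA mulrAC mulrA mulrA ler_pdivrMr//.
by rewrite exprMn in ss; have := sqr_ge0 s; have := sqr_ge0 k;
  have := sqr_ge0 t; nra.
Qed.

End hyperbolic.

(** * Gaussian means of 1 / cosh and the closed form of F *)

Section channel_overlap.
Context {R : realType}.
Implicit Types q c s : R.
Local Notation gauss := (normal_prob (0 : R) 1).
Local Notation F := (@Foverlap R).

Let gaussT : gauss setT = 1%E.
Proof. exact: (@probability_setT _ _ _ gauss). Qed.

Lemma integrable_gauss_bounded (f : R -> R) : continuous f ->
  (forall x, `|f x| <= 1) -> gauss.-integrable setT (EFin \o f).
Proof.
move=> cf f1; apply: measurable_bounded_integrable => //.
- by rewrite [X in (X < _)%E](_ : _ = 1%E) ?ltry//; exact: gaussT.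
- exact: continuous_measurable_fun.
- by exists 1; split=> // M M1 x _ /=; rewrite (le_trans (f1 _))// ltW.
Qed.

Lemma continuous_linear_comp (f : R -> R) (a b : R) : continuous f ->
  continuous (fun x => f (a * x + b)).
Proof.
move=> cf x; apply: (@continuous_comp _ _ _ (fun x => a * x + b)).
  by apply: cvgD; [exact: mulrl_continuous|exact: cvg_cst].
exact: cf.
Qed.

Definition mean_sech s : R := (\int[gauss]_z (cosh (s * z))^-1)%R.

Lemma coshV_ge0 (x : R) : 0 <= (cosh x)^-1.
Proof. by rewrite invr_ge0 ltW// cosh_gt0. Qed.

Lemma coshV_le1 (x : R) : (cosh x)^-1 <= 1.
Proof. by rewrite invf_le1 ?cosh_gt0// cosh_ge1. Qed.

Lemma continuous_coshV s : continuous (fun z : R => (cosh (s * z))^-1).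
Proof.
move=> x; apply: cvgV; first exact: lt0r_neq0 (cosh_gt0 _).
apply: (@continuous_comp _ _ _ (fun x => s * x)).
  exact: mulrl_continuous.
exact: continuous_cosh.
Qed.

Lemma integrable_sech s :
  gauss.-integrable setT (EFin \o (fun z : R => (cosh (s * z))^-1)).
Proof.
apply: integrable_gauss_bounded; first exact: continuous_coshV.
by move=> x; rewrite ger0_norm ?coshV_ge0 ?coshV_le1.
Qed.

Lemma integrable_gauss_cst c : gauss.-integrable setT (EFin \o (fun=> c)).
Proof. exact: finite_measure_integrable_cst. Qed.

Lemma Rintegral_gauss_cst c : (\int[gauss]_z c)%R = c.
Proof.
have := @Rintegral_cst _ _ R gauss setT measurableT c.
by rewrite [X in fine X](_ : _ = 1%E) /= ?mulr1//; exact: gaussT.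
Qed.

Lemma integrable_gauss_expR s :
  gauss.-integrable setT (EFin \o (fun z : R => expR (s * z))).
Proof.
apply/integrableP; split.
  apply/measurable_EFinP.
  have : measurable_fun [set: R] (fun z : R => expR (s * z)).
    by apply: measurableT_comp => //; exact: measurable_funM.
  by [].
under eq_integral do rewrite /= ger0_norm ?expR_ge0//.
by rewrite integral_normal_expR ltry.
Qed.

Lemma Rintegral_gauss_expR s : (\int[gauss]_z expR (s * z))%R = expR (s ^+ 2 / 2).
Proof. by rewrite /Rintegral integral_normal_expR. Qed.

Lemma integrable_gauss_cosh s :
  gauss.-integrable setT (EFin \o (fun z : R => cosh (s * z))).
Proof.
have -> : EFin \o (fun z : R => cosh (s * z)) =
    (fun z => (2^-1)%:E * ((EFin \o (fun z => expR (s * z))) z +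
                   (EFin \o (fun z => expR (- s * z))) z))%E.
  apply/funext => z /=; rewrite -EFinD -EFinM /cosh mulNr.
  by congr EFin; rewrite [RHS]mulrC.
by apply: integrableZl => //; apply: integrableD => //; exact: integrable_gauss_expR.
Qed.

Lemma Rintegral_gauss_cosh s : (\int[gauss]_z cosh (s * z))%R = expR (s ^+ 2 / 2).
Proof.
have -> : (\int[gauss]_z cosh (s * z))%R =
    (\int[gauss]_z (2^-1 * (expR (s * z) + expR (- s * z))))%R.
  by apply: eq_Rintegral => z _; rewrite /cosh mulNr [RHS]mulrC.
have iD : gauss.-integrable setT
    (EFin \o (fun z => expR (s * z) + expR (- s * z))).
  exact: (integrableD measurableT (integrable_gauss_expR s)
            (integrable_gauss_expR (- s))).
rewrite [LHS](RintegralZl _ measurableT iD).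
rewrite [X in _ * X](RintegralD measurableT (integrable_gauss_expR s)
  (integrable_gauss_expR (- s))).
by rewrite !Rintegral_gauss_expR sqrrN; lra.
Qed.

Lemma mean_sech_ge0 s : 0 <= mean_sech s.
Proof. by apply: Rintegral_ge0 => x _; exact: coshV_ge0. Qed.

Lemma mean_sech_le1 s : mean_sech s <= 1.
Proof.
rewrite -[leRHS]Rintegral_gauss_cst; apply: le_Rintegral => //.
- exact: integrable_sech.
- exact: integrable_gauss_cst.
- by move=> x _; exact: coshV_le1.
Qed.

Lemma mean_sech0 : mean_sech 0 = 1.
Proof.
rewrite -[RHS]Rintegral_gauss_cst; apply: eq_Rintegral => x _.
by rewrite mul0r cosh0 invr1.
Qed.

Lemma le_mean_sech r s : 0 <= r <= s -> mean_sech s <= mean_sech r.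
Proof.
move=> /andP[r0 rs]; apply: le_Rintegral => //; try exact: integrable_sech.
move=> x _; rewrite lef_pV2 ?posrE ?cosh_gt0//; apply: ler_cosh.
by rewrite !normrM ler_wpM2r// !ger0_norm// (le_trans r0).
Qed.

Lemma mean_sech_star k s : 0 <= k <= 1 ->
  mean_sech (k * s) <= 1 - k ^+ 2 + k ^+ 2 * mean_sech s.
Proof.
move=> k01.
have -> : 1 - k ^+ 2 + k ^+ 2 * mean_sech s =
    (\int[gauss]_z (1 - k ^+ 2 + k ^+ 2 * (cosh (s * z))^-1))%R.
  have iZ := integrableZl measurableT (k ^+ 2) (integrable_sech s).
  rewrite [RHS](RintegralD measurableT (integrable_gauss_cst (1 - k ^+ 2)) iZ).
  rewrite Rintegral_gauss_cst; congr (_ + _).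
  by rewrite [RHS](RintegralZl _ measurableT (integrable_sech s)).
apply: le_Rintegral => //; first exact: integrable_sech.
  exact: (integrableD measurableT (integrable_gauss_cst (1 - k ^+ 2))
    (integrableZl measurableT (k ^+ 2) (integrable_sech s))).
by move=> z _; rewrite -mulrA; exact: coshV_star.
Qed.

(* Jensen: 1 / c >= 2 a - a^2 c, with a the inverse mean of c = cosh (s z). *)
Lemma mean_sech_ge s : expR (- (s ^+ 2 / 2)) <= mean_sech s.
Proof.
set a := expR _.
have a0 : 0 < a by exact: expR_gt0.
have -> : a = (\int[gauss]_z (2 * a - a ^+ 2 * cosh (s * z)))%R.
  have iZ := integrableZl measurableT (a ^+ 2) (integrable_gauss_cosh s).
  rewrite [RHS](RintegralB measurableT (integrable_gauss_cst (2 * a)) iZ).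
  rewrite Rintegral_gauss_cst.
  rewrite [X in _ - X](RintegralZl _ measurableT (integrable_gauss_cosh s)).
  rewrite Rintegral_gauss_cosh expr2 -mulrA /a expRN mulVf ?mulr1; first lra.
  exact: lt0r_neq0 (expR_gt0 _).
apply: le_Rintegral => //; last 2 first.
- exact: integrable_sech.
- move=> z _; have c0 := cosh_gt0 (s * z).
  rewrite -subr_ge0; set c := cosh _ in c0 *.
  have -> : c^-1 - (2 * a - a ^+ 2 * c) = (1 - a * c) ^+ 2 / c.
    by field; rewrite lt0r_neq0.
  by rewrite divr_ge0 ?sqr_ge0// ltW.
exact: (integrableB measurableT (integrable_gauss_cst (2 * a))
  (integrableZl measurableT (a ^+ 2) (integrable_gauss_cosh s))).
Qed.

(* 1 / c <= 3 - 3 c + c^2 for c >= 1, a second-order expansion at c = 1. *)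
Lemma mean_sech_le s : mean_sech s <=
  3 - 3 * expR (s ^+ 2 / 2) + (expR (2 * s ^+ 2) + 1) / 2.
Proof.
have Rc2 : (\int[gauss]_z (cosh (2 * s * z)))%R = expR (2 * s ^+ 2).
  by rewrite Rintegral_gauss_cosh; congr expR; field.
(* By the double-angle formula [coshMM], this integrand is 3 - 3 c + c^2 at c = cosh (s z), written
   so that each term has a known mean. *)
have <- : (\int[gauss]_z (7 / 2 + (2^-1 * cosh (2 * s * z) - 3 * cosh (s * z))))%R =
   3 - 3 * expR (s ^+ 2 / 2) + (expR (2 * s ^+ 2) + 1) / 2.
  have i1 := integrableZl measurableT 2^-1 (integrable_gauss_cosh (2 * s)).
  have i2 := integrableZl measurableT 3 (integrable_gauss_cosh s).
  rewrite [LHS](RintegralD measurableT (integrable_gauss_cst (7 / 2))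
    (integrableB measurableT i1 i2)).
  rewrite [X in _ + X](RintegralB measurableT i1 i2) Rintegral_gauss_cst.
  rewrite [X in _ + (X - _)](RintegralZl _ measurableT (integrable_gauss_cosh (2 * s))).
  rewrite [X in _ + (_ - X)](RintegralZl _ measurableT (integrable_gauss_cosh s)).
  by rewrite Rc2 Rintegral_gauss_cosh; lra.
apply: le_Rintegral => //; first exact: integrable_sech.
  exact: (integrableD measurableT (integrable_gauss_cst (7 / 2))
    (integrableB measurableT
      (integrableZl measurableT 2^-1 (integrable_gauss_cosh (2 * s)))
      (integrableZl measurableT 3 (integrable_gauss_cosh s)))).
move=> z _; have := coshMM (s * z); rewrite mulrA.
have := cosh_ge1 (s * z); set c := cosh (s * z); move=> c1 c2.
have c0 : 0 < c by exact: lt_le_trans c1.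
have -> : cosh (2 * s * z) = 2 * c ^+ 2 - 1 by lra.
rewrite -subr_ge0.
have -> : 7 / 2 + (2^-1 * (2 * c ^+ 2 - 1) - 3 * c) - c^-1 =
   (c - 1) ^+ 3 / c by field; rewrite lt0r_neq0.
by rewrite divr_ge0 ?exprn_ge0 ?subr_ge0// ltW.
Qed.

(* Reweighting the density of N(s, 1) to that of N(0, 1), s = sqrt q, turns
   1 - tanh (s x) = exp (- s x) / cosh (s x) into 1 / cosh (s x). *)
Lemma FoverlapE q : 0 <= q ->
  F q = 1 - expR (- (q / 2)) * mean_sech (Num.sqrt q).
Proof.
move=> q0; rewrite /Foverlap unlock; set s := Num.sqrt q.
have sq : s ^+ 2 = q by exact: sqr_sqrtr.
clearbody s.
rewrite -/(Rintegral gauss setT (fun z => tanh (s * z + q))).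
(* Unlike tanh itself, 1 - tanh is nonnegative, so the density and shift lemmas apply to it. The
   shift by s appears through s (z + s) = s z + q. *)
pose f x : R := 1 - tanh (s * x).
have f0 x : 0 <= f x by rewrite subr_ge0 tanh_le1.
have cf : continuous f.
  move=> x; apply: cvgB; first exact: cvg_cst.
  apply: (@continuous_comp _ _ _ (fun x => s * x)).
    exact: mulrl_continuous.
  exact: continuous_tanh.
have ct : continuous (fun z => tanh (s * z + q)).
  by apply: continuous_linear_comp; exact: continuous_tanh.
have it : gauss.-integrable setT (EFin \o (fun z => tanh (s * z + q))).
  apply: integrable_gauss_bounded => // x; rewrite ler_norml tanh_le1 andbT.
  rewrite tanhE; set y := s * x + q.
  have y0 := cosh_gt0 y.
  suff : expR (- y) / cosh y <= 2 by lra.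
  rewrite ler_pdivrMr// /cosh; have := expR_gt0 y; lra.
have E : (\int[gauss]_z (1 - tanh (s * z + q)))%R =
    expR (- (q / 2)) * mean_sech s.
  rewrite /Rintegral.
  under eq_integral => z _.
    have -> : 1 - tanh (s * z + q) = f (z + s) by rewrite /f mulrDr -expr2 sq.
    over.
  rewrite (ge0_integral_normal_shift _ cf f0) ge0_integral_normal_prob//; last first.
    exact: continuous_measurable_fun.
  under eq_integral => z _.
    have -> : f z * normal_pdf s 1 z =
      expR (- (q / 2)) * ((cosh (s * z))^-1 * normal_pdf 0 1 z).
      have -> : normal_pdf s 1 z = expR (- (q / 2)) * (expR (s * z) * normal_pdf 0 1 z).
        have e : expR (- (q / 2)) * expR (q / 2) = 1.
          by rewrite mulrC expRxMexpNx_1.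
        by rewrite (normal_pdf_expR s z) sq mulrA e mul1r.
      rewrite /f tanhE subKr expRN; field.
      by rewrite !lt0r_neq0 ?expR_gt0 ?cosh_gt0.
    rewrite EFinM; over.
  rewrite ge0_integralZl//=; last 2 first.
  - apply/measurable_EFinP; apply: measurable_funM; last exact: measurable_normal_pdf.
    by apply: continuous_measurable_fun; exact: continuous_coshV.
  - by move=> x _; rewrite lee_fin mulr_ge0 ?coshV_ge0 ?normal_pdf_ge0.
  rewrite -ge0_integral_normal_prob//; last 2 first.
  - by apply: continuous_measurable_fun; exact: continuous_coshV.
  - by move=> x; exact: coshV_ge0.
  rewrite fineM// integrable_fin_num//; exact: integrable_sech.
rewrite -E RintegralB//; last exact: integrable_gauss_cst.
by rewrite Rintegral_gauss_cst subKr.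
Qed.

End channel_overlap.

(** * Monotonicity, subhomogeneity and expansion of F *)

Section overlap_function.
Context {R : realType}.
Implicit Types q c h : R.
Local Notation F := (@Foverlap R).

Lemma Foverlap0 : F 0 = 0.
Proof. by rewrite FoverlapE// sqrtr0 mean_sech0 mul0r oppr0 expR0; lra. Qed.

(** In [FoverlapE] both factors of 1 - F decrease, the exponential strictly, and [mean_sech] stays
    positive. *)
Lemma Foverlap_lt q r : 0 <= q -> q < r -> F q < F r.
Proof.
move=> q0 qr; have r0 : 0 <= r by rewrite (le_trans q0)// ltW.
have e : expR (- (r / 2)) < expR (- (q / 2)) by rewrite ltr_expR; lra.
rewrite !FoverlapE// ltrD2l ltrN2.
have mr : 0 < mean_sech (Num.sqrt r).
  by apply: lt_le_trans (mean_sech_ge _); exact: expR_gt0.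
have mqr : mean_sech (Num.sqrt r) <= mean_sech (Num.sqrt q).
  by apply: le_mean_sech; rewrite sqrtr_ge0/= ler_wsqrtr// ltW.
apply: (@lt_le_trans _ _ (expR (- (q / 2)) * mean_sech (Num.sqrt r))).
  by rewrite (ltr_pM2r mr).
by rewrite ler_wpM2l// expR_ge0.
Qed.

Lemma Foverlap_le q r : 0 <= q -> q <= r -> F q <= F r.
Proof.
move=> q0; rewrite le_eqVlt => /predU1P[->//|qr].
by rewrite ltW// Foverlap_lt.
Qed.

Lemma Foverlap_gt0 q : 0 < q -> 0 < F q.
Proof. by move=> q0; rewrite -Foverlap0 Foverlap_lt. Qed.

Lemma Foverlap_ge0 q : 0 <= q -> 0 <= F q.
Proof. by move=> q0; rewrite -Foverlap0 Foverlap_le. Qed.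

(** Both factors of 1 - F lie below their chords from 0 to q. As both also decrease from 1, their
    product lies below its chord. *)
Lemma Foverlap_star c q : 0 <= c <= 1 -> 0 <= q -> c * F q <= F (c * q).
Proof.
move=> /andP[c0 c1] q0; rewrite !FoverlapE ?mulr_ge0// sqrtrM//.
have k01 : 0 <= Num.sqrt c <= 1 by rewrite sqrtr_ge0 -[leRHS]sqrtr1 ler_wsqrtr.
have := mean_sech_star (Num.sqrt q) k01; rewrite sqr_sqrtr//.
have := mean_sech_le1 (Num.sqrt q); have := mean_sech_ge0 (Num.sqrt q).
move: (mean_sech (_ * _)) (mean_sech (Num.sqrt q)) => mc m m0 m1 mcm.
set b := expR (- (c * q / 2)); set a := expR (- (q / 2)).
have b0 : 0 < b by exact: expR_gt0.
have ab : a <= b by rewrite ler_expR; nra.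
(* Convexity of x |-> exp (- x): the tangent at c q / 2 is evaluated at 0 in [h1] and at q / 2 in
   [h2], then averaged with weights 1 - c and c. *)
have cvx : b <= 1 - c + c * a.
  have h1 : b * (1 + c * q / 2) <= 1.
    rewrite -[leRHS](expRxMexpNx_1 (c * q / 2)) mulrC; apply: ler_wpM2r.
      exact: expR_ge0.
    exact: expR_ge1Dx.
  have h2 : b * (1 - (1 - c) * q / 2) <= a.
    have -> : a = b * expR (- ((1 - c) * q / 2)).
      by rewrite -expRD; congr expR; lra.
    apply: ler_wpM2l; first exact: ltW.
    by have := expR_ge1Dx (- ((1 - c) * q / 2)); lra.
  have := ler_wpM2l c0 h2; have := @ler_wpM2l _ (1 - c) _ _ _ h1.
  by rewrite subr_ge0 => /(_ c1); lra.
have h3 := ler_wpM2l (ltW b0) mcm.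
have h4 : 0 <= (1 - m) * (c * (b - a)) by apply: mulr_ge0; [lra|apply: mulr_ge0; lra].
have h5 : 0 <= 1 - b by rewrite subr_ge0 -expR0 ler_expR; nra.
by lra.
Qed.

(** Jensen's bound [mean_sech_ge] gives F q <= 1 - exp (- q) < q. *)
Lemma Foverlap_lt_id q : 0 < q -> F q < q.
Proof.
move=> q0; rewrite FoverlapE ?ltW//.
have := mean_sech_ge (Num.sqrt q); rewrite (sqr_sqrtr (ltW q0)) => m.
have := ler_wpM2l (expR_ge0 (- (q / 2))) m.
rewrite -expRD (_ : _ + _ = - q); last by lra.
by have := @expR_gt1Dx R (- q); rewrite oppr_eq0 gt_eqF// => /(_ isT); lra.
Qed.

Lemma Foverlap_le_id q : 0 <= q -> F q <= q.
Proof.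
rewrite le_eqVlt => /predU1P[<-|q0]; first by rewrite Foverlap0.
by rewrite ltW// Foverlap_lt_id.
Qed.

(** Multiplying [mean_sech_le] by exp (- q / 2) leaves only exp (- q / 2) and exp (3 q / 2), bounded
    to second order in [h2] and [h3]. The first-order terms then add up to q. *)
Lemma Foverlap_ge_quadratic q : 0 <= q <= 3^-1 -> q * (1 - 4 * q) <= F q.
Proof.
move=> /andP[q0 q1]; rewrite FoverlapE//.
have := mean_sech_le (Num.sqrt q); rewrite sqr_sqrtr//.
move: (mean_sech _) => m hm.
set u := expR (- (q / 2)).
have u0 : 0 < u by exact: expR_gt0.
have e1 : u * expR (q / 2) = 1 by rewrite /u mulrC expRxMexpNx_1.
have e2 : u * expR (2 * q) = expR (3 * q / 2).
  by rewrite /u -expRD; congr expR; lra.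
have h1 : u * m <= 3 * u - 3 + (expR (3 * q / 2) + u) / 2.
  apply: (le_trans (ler_wpM2l (ltW u0) hm)); rewrite -e2.
  by rewrite mulrDr mulrBr mulrCA e1; lra.
have h2 : u <= 1 - q / 2 + q ^+ 2 / 4.
  have : u * (1 + q / 2) <= 1.
    by rewrite -[leRHS]e1; apply: ler_wpM2l; [exact: ltW|exact: expR_ge1Dx].
  have : 0 <= q ^+ 3 by exact: exprn_ge0.
  by nra.
(* Here q <= 1/3 enters: (1 - 3q/2) (1 + 3q/2 + 9q^2/2) = 1 + (9/4) q^2 (1 - 3q) >= 1. *)
have h3 : expR (3 * q / 2) <= 1 + 3 * q / 2 + 9 / 2 * q ^+ 2.
  have p0 := expR_gt0 (3 * q / 2).
  have : expR (3 * q / 2) * (1 - 3 * q / 2) <= 1.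
    rewrite -[leRHS](expRxMexpNx_1 (3 * q / 2)); apply: ler_wpM2l; first exact: ltW.
    by have := expR_ge1Dx (- (3 * q / 2)); lra.
  have : 0 <= q ^+ 2 * (1 - 3 * q) by rewrite mulr_ge0 ?sqr_ge0//; lra.
  by nra.
by nra.
Qed.

(** Subhomogeneity implies subadditivity: with c = q / (q + h), c F (q + h) <= F q and (1 - c) F (q
    + h) <= F h <= h. *)
Lemma Foverlap_lip q h : 0 <= q -> 0 <= h -> F (q + h) <= F q + h.
Proof.
move=> q0; rewrite le_eqVlt => /predU1P[<-|h0]; first by rewrite !addr0.
have p : 0 < q + h by rewrite ltr_wpDl.
pose c := q / (q + h).
have cq : c * (q + h) = q by rewrite divfK// gt_eqF.
have c0 : 0 <= c by rewrite divr_ge0// ltW.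
have c1 : c <= 1 by rewrite ler_pdivrMr// mul1r lerDl ltW.
have ch : (1 - c) * (q + h) = h by rewrite mulrBl mul1r cq; lra.
have := @Foverlap_star c (q + h); rewrite cq c0 c1 => /(_ isT (ltW p)).
have := @Foverlap_star (1 - c) (q + h); rewrite ch subr_ge0 c1 gerBl c0.
move=> /(_ isT (ltW p)); have := Foverlap_le_id (ltW h0); lra.
Qed.

End overlap_function.

(** * Monotone subhomogeneous maps on the orthant *)

Section coordinatewise.
Context {R : realType} {n : nat}.
Implicit Types (x y : 'rV[R]_n) (a : 'I_n -> R).

Definition coord_le x y := forall t, x 0 t <= y 0 t.

Lemma coord_le_trans x y z : coord_le x y -> coord_le y z -> coord_le x z.
Proof. by move=> xy yz t; exact: le_trans (xy t) (yz t). Qed.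

Lemma subrvE x y t : (x - y) 0 t = x 0 t - y 0 t.
Proof. by rewrite !mxE. Qed.

Lemma scalervE (c : R) x t : (c *: x) 0 t = c * x 0 t.
Proof. by rewrite mxE. Qed.

Lemma rV_norm_ltP x (e : R) : 0 < e ->
  `|x| < e <-> forall t, `|x 0 t| < e.
Proof.
move=> e0; have -> : `|x| = mx_norm x by [].
rewrite mx_normrE; split.
  by move=> /bigmax_ltP[_ H] t; exact: (H (0, t)).
by move=> H; apply/bigmax_ltP; split => // -[i j] _ /=; rewrite ord1.
Qed.

Lemma exists_pos_lb a : (forall t, 0 < a t) ->
  exists2 d : R, 0 < d & forall t, d <= a t.
Proof.
(* This explicit bound replaces a minimum, and the summand 1 keeps it meaningful for n = 0. *)
move=> a0; exists (1 + \sum_t (a t)^-1)^-1 => [|t].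
  rewrite invr_gt0 ltr_pwDl// sumr_ge0// => t _.
  by rewrite invr_ge0 ltW.
rewrite -[leRHS]invrK lef_pV2 ?posrE ?invr_gt0//; last first.
  by rewrite ltr_pwDl// sumr_ge0// => s _; rewrite invr_ge0 ltW.
rewrite (bigD1 t)//= addrCA lerDl addr_ge0// sumr_ge0// => s _.
by rewrite invr_ge0 ltW.
Qed.

End coordinatewise.

(** Bernoulli's inequality combined with the Archimedean property. *)
Lemma exists_expr_ge (R : realType) (h b : R) : 0 < h ->
  exists n, b <= (1 + h) ^+ n.
Proof.
move=> h0; exists (Num.bound `|b / h|).
apply: (@le_trans _ _ (1 + (Num.bound `|b / h|)%:R * h)).
  have := archi_boundP (normr_ge0 (b / h)).
  move=> /(le_lt_trans (ler_norm _)); rewrite ltr_pdivrMr// => /ltW bh.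
  by rewrite (le_trans bh)// lerDr.
elim: (Num.bound _) => [|n IH]; first by rewrite mul0r addr0 expr0.
rewrite exprSr mulrDr mulr1 mulrSr.
have : 1 <= (1 + h) ^+ n by rewrite exprn_ege1// lerDl ltW.
by move=> /(ler_wpM2r (ltW h0)); nra.
Qed.

Section monotone_subhomogeneous.
Context {R : realType} {T : nat}.
Context (G : 'rV[R]_T -> 'rV[R]_T) (m : 'rV[R]_T).
Implicit Types (x y : 'rV[R]_T) (c : R).

Context (G_ge0 : forall x, orthant x -> orthant (G x)).
Context (G_homo : forall x y, orthant x -> coord_le x y -> coord_le (G x) (G y)).
Context (G_homo_lt : forall x y, orthant x ->
  (forall t, x 0 t < y 0 t) -> forall t, G x 0 t < G y 0 t).
Context (G_star : forall c x, 0 <= c <= 1 -> orthant x ->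
  coord_le (c *: G x) (G (c *: x))).
Context (G_star_lt : forall c x t, 0 < c < 1 -> orthant x -> 0 < x 0 t ->
  c * G x 0 t < G (c *: x) 0 t).
Context (G_ub : forall x, orthant x -> coord_le (G x) m).
(** One-sided continuity from above, the form in which the limit of a decreasing orbit is shown to
    be a fixed point. *)
Context (G_lip : forall x, orthant x -> exists2 K : R, 0 <= K &
  forall y, coord_le x y ->
    forall t, G y 0 t <= G x 0 t + K * \sum_s (y 0 s - x 0 s)).

(** Starting strictly above the bound [m] keeps every iterate strictly above the limit, which leaves
    room for a neighbourhood in the stability proof. *)
Let top : 'rV[R]_T := m + const_mx 1.
Let y n := iter n G top.

Lemma orthant_le x x' : orthant x -> coord_le x x' -> orthant x'.
Proof. by move=> x0 xx' t; exact: le_trans (x0 t) (xx' t). Qed.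

Lemma orthantZ c x : 0 <= c -> orthant x -> orthant (c *: x).
Proof. by move=> c0 x0 t; rewrite mxE mulr_ge0. Qed.

Let m_ge0 : orthant m.
Proof.
have o0 : orthant (0 : 'rV[R]_T) by move=> t; rewrite mxE.
exact: orthant_le (G_ge0 o0) (G_ub o0).
Qed.

Let m_lt_top t : m 0 t < top 0 t.
Proof. by rewrite !mxE ltrDl. Qed.

Let top_ge0 : orthant top.
Proof. by move=> t; rewrite (le_trans (m_ge0 t))// ltW. Qed.

Let y_ge0 n : orthant (y n).
Proof. by elim: n => //= n; exact: G_ge0. Qed.

Let y_succ n : coord_le (y n.+1) (y n).
Proof.
elim: n => [t|n IH]; last exact: G_homo (y_ge0 n.+1) IH.
by rewrite /= (le_trans (G_ub top_ge0 t))// ltW.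
Qed.

Let y_le i j : (i <= j)%N -> coord_le (y j) (y i).
Proof.
elim: j => [|j IH]; first by rewrite leqn0 => /eqP->.
rewrite leq_eqVlt => /predU1P[->//|]; rewrite ltnS => /IH.
exact: coord_le_trans (y_succ j).
Qed.

(** The iterates decrease, so the coordinatewise infimum encodes their limit. *)
Definition top_fixpoint : 'rV[R]_T :=
  \row_t inf (range (fun n => iter n G (m + const_mx 1) 0 t)).
Local Notation q := top_fixpoint.

Let q_le n : coord_le q (y n).
Proof.
move=> t; rewrite mxE; apply: ge_inf; last by exists n.
by exists 0 => _ [k _ <-]; exact: (y_ge0 k).
Qed.

Let q_ge x : (forall n, coord_le x (y n)) -> coord_le x q.
Proof.
move=> xy t; rewrite mxE; apply: lb_le_inf; first by exists (y 0 0 t); exists 0.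
by move=> _ [k _ <-]; exact: (xy k).
Qed.

Let q_approx e : 0 < e -> exists n, forall t, y n 0 t < q 0 t + e.
Proof.
move=> e0.
have H t : exists n, y n 0 t < q 0 t + e.
  have [_ [n _ <-]] : exists2 z, range (fun n => y n 0 t) z & z < q 0 t + e.
    rewrite mxE; apply: inf_adherent => //; split; first by exists (y 0 0 t); exists 0.
    by exists 0 => _ [k _ <-]; exact: (y_ge0 k).
  by exists n.
have [f fP] := choice H.
exists (\max_t f t) => t; apply: le_lt_trans (fP t).
by apply: y_le; exact: leq_bigmax.
Qed.

Lemma top_fixpoint_ge0 : orthant q.
Proof.
apply: (@orthant_le 0); first by move=> t; rewrite mxE.
by apply: q_ge => n t; rewrite mxE; exact: y_ge0.
Qed.
Let q_ge0 := top_fixpoint_ge0.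

Lemma top_fixpointP : G q = q.
Proof.
have [K K0 GK] := G_lip q_ge0.
apply/rowP => t; apply/eqP; rewrite eq_le; apply/andP; split.
  have Gq : coord_le (G q) q; last exact: Gq.
  apply: q_ge => -[|n]; last exact: G_homo.
  by move=> s; rewrite /= (le_trans (G_ub q_ge0 s))// ltW.
(* For q <= G q: q <= y (n+1) = G (y n) <= G q + K times the sum of y n - q, with n chosen so that
   each coordinate gap is below e / (1 + K T). *)
apply/ler_addgt0Pl => e e0.
have K1 : 0 < 1 + K * T%:R by rewrite ltr_pwDl// mulr_ge0.
have [n yn] := q_approx (divr_gt0 e0 K1).
apply: (le_trans (q_le n.+1 t)); rewrite addrC /=.
apply: (le_trans (GK _ (q_le n) t)); rewrite lerD2l.
apply: (@le_trans _ _ (K * \sum_(s < T) (e / (1 + K * T%:R)))).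
  apply: ler_wpM2l => //; apply: ler_sum => s _.
  by rewrite lerBlDl ltW.
rewrite sumr_const card_ord -(mulr_natr (e / _)).
have -> : K * (e / (1 + K * T%:R) * T%:R) = e * ((K * T%:R) / (1 + K * T%:R)).
  by ring.
rewrite ler_piMr ?(ltW e0)// ler_pdivrMr// mul1r; lra.
Qed.

Lemma subsolution_le_top_fixpoint x : orthant x -> coord_le x (G x) ->
  coord_le x q.
Proof.
move=> x0 xG; apply: q_ge; elim=> [|n IH]; last first.
  exact: coord_le_trans xG (G_homo x0 IH).
by move=> t; rewrite (le_trans (xG t))// (le_trans (G_ub x0 t))// ltW.
Qed.

Let q_lt n t : q 0 t < y n 0 t.
Proof.
elim: n t => [|n IH] t.
  by rewrite (le_lt_trans _ (m_lt_top t))// -top_fixpointP; exact: G_ub.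
by rewrite -[in ltLHS]top_fixpointP; exact: G_homo_lt.
Qed.

(** The box between (1 - h) q and y N is invariant under G, contains a neighbourhood of q relative
    to the orthant, and lies within e of q. *)
Lemma top_fixpoint_stable : lyapunov_stable (@orthant R T) G q.
Proof.
move=> e e0.
have [N yN] := q_approx e0.
have S0 : 0 <= \sum_s q 0 s by rewrite sumr_ge0// => s _; exact: q_ge0.
have S1 : 0 < 1 + \sum_s q 0 s by rewrite ltr_pwDl.
pose h := Num.min 1 (e / (1 + \sum_s q 0 s)).
have h0 : 0 < h by rewrite lt_min ltr01 divr_gt0.
have h1 : h <= 1 by rewrite ge_min lexx.
have hq t : h * q 0 t < e.
  apply: (@le_lt_trans _ _ (e / (1 + \sum_s q 0 s) * q 0 t)).
    by rewrite ler_wpM2r ?q_ge0// ge_min lexx orbT.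
  rewrite mulrAC ltr_pdivrMr// ltr_pM2l// ltr_pwDl// (bigD1 t)//= lerDl.
  by rewrite sumr_ge0// => s _; exact: q_ge0.
have [d1 d10 d1P] := exists_pos_lb (a := fun t => y N 0 t - q 0 t)
  (fun t => etrans (subr_gt0 _ _) (q_lt N t)).
(* Where q vanishes the box already reaches down to 0, so any positive radius serves there and 1 is
   a placeholder. *)
have a0 t : 0 < (if 0 < q 0 t then h * q 0 t else 1).
  by case: ifPn => // qt; exact: mulr_gt0.
have [d2 d20 d2P] := exists_pos_lb a0.
have d0 : 0 < Num.min d1 d2 by rewrite lt_min d10.
exists (Num.min d1 d2) => // x x0 /(rV_norm_ltP _ d0) xq n.
have qx : coord_le ((1 - h) *: q) x.
  move=> t; rewrite scalervE; have := xq t; have := d2P t.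
  rewrite subrvE; case: ifPn => [qt|]; last first.
    by move=> /negP; rewrite lt_def q_ge0 andbT => /negP/negPn/eqP -> _ _; rewrite mulr0.
  move=> d2q; rewrite lt_min => /andP[_]; rewrite distrC => /(le_lt_trans (ler_norm _)).
  lra.
have xy : coord_le x (y N).
  move=> t; have := xq t; have := d1P t; rewrite subrvE.
  rewrite lt_min => d1q /andP[/(le_lt_trans (ler_norm _))]; lra.
have h1q : orthant ((1 - h) *: q) by apply: orthantZ; rewrite ?subr_ge0.
have [xn0 qxn xny] : [/\ orthant (iter n G x), coord_le ((1 - h) *: q) (iter n G x)
    & coord_le (iter n G x) (y N)].
  elim: n => // n [xn0 qxn xny]; split; first exact: G_ge0.
  - apply: coord_le_trans (G_homo h1q qxn).
    rewrite -[in X in coord_le X _]top_fixpointP; apply: G_star => //; lra.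
  - exact: coord_le_trans (G_homo xn0 xny) (y_succ N).
apply/rV_norm_ltP => // t; rewrite subrvE.
have := qxn t; have := xny t; have := yN t; have := hq t; rewrite scalervE ltr_norml.
by move=> *; apply/andP; split; lra.
Qed.

(* A perturbation p + d q dominates d q, and iterating G on d q climbs
   geometrically above any c q with c < 1. *)
Lemma stable_fixpoint_unique p : orthant p -> G p = p ->
  lyapunov_stable (@orthant R T) G p -> p = q.
Proof.
move=> p0 Gp stp.
have pq : coord_le p q.
  by apply: subsolution_le_top_fixpoint => // t; rewrite Gp.
apply/rowP => t; apply/eqP; rewrite eq_le pq /= leNgt; apply/negP => ptq.
have qt0 : 0 < q 0 t by exact: le_lt_trans (p0 t) ptq.
(* Midpoint of p_t / q_t and 1: it satisfies c0 < 1 and c0 q_t > p_t, so an orbit reaching c0 q has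
   left a fixed neighbourhood of p. *)
pose c0 := (p 0 t / q 0 t + 1) / 2.
have r0 : 0 <= p 0 t / q 0 t by rewrite divr_ge0.
have r1 : p 0 t / q 0 t < 1 by rewrite ltr_pdivrMr// mul1r.
have c00 : 0 < c0 by rewrite /c0; lra.
have c01 : c0 < 1 by rewrite /c0; lra.
have ce : 0 < c0 * q 0 t - p 0 t.
  have : p 0 t = p 0 t / q 0 t * q 0 t by rewrite divfK// gt_eqF.
  by rewrite /c0; nra.
have [d d0 dP] := stp _ ce.
(* Strict subhomogeneity at c0 q gives each positive coordinate a growth factor above 1; [h] is a
   uniform margin. *)
have a0 s : 0 < (if 0 < q 0 s then G (c0 *: q) 0 s / (c0 * q 0 s) - 1 else 1).
  case: ifPn => // qs; rewrite subr_gt0 (ltr_pdivlMr _ _ (mulr_gt0 c00 qs)) mul1r.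
  by rewrite -{1}top_fixpointP; apply: G_star_lt => //; rewrite c00.
have [h h0 hP] := exists_pos_lb a0.
have hG : coord_le (((1 + h) * c0) *: q) (G (c0 *: q)).
  move=> s; rewrite scalervE; have := hP s; case: ifPn => [qs|].
    by rewrite lerBrDl (ler_pdivlMr _ _ (mulr_gt0 c00 qs)) mulrA.
  move=> /negP; rewrite lt_def q_ge0 andbT => /negP/negPn/eqP -> _.
  by rewrite mulr0; apply: G_ge0; apply: orthantZ => //; exact: ltW.
have S0 : 0 <= \sum_s q 0 s by rewrite sumr_ge0// => s _; exact: q_ge0.
have S1 : 0 < 1 + \sum_s q 0 s by rewrite ltr_pwDl.
pose g := Num.min c0 (d / (1 + \sum_s q 0 s)).
have g0 : 0 < g by rewrite lt_min c00 divr_gt0.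
have gc : g <= c0 by rewrite ge_min lexx.
have gq s : g * q 0 s < d.
  apply: (@le_lt_trans _ _ (d / (1 + \sum_s q 0 s) * q 0 s)).
    by rewrite ler_wpM2r ?q_ge0// ge_min lexx orbT.
  rewrite mulrAC ltr_pdivrMr// ltr_pM2l// ltr_pwDl// (bigD1 s)//= lerDl.
  by rewrite sumr_ge0// => i _; exact: q_ge0.
pose x := p + g *: q.
have x0 : orthant x by move=> s; rewrite mxE scalervE addr_ge0 ?mulr_ge0// ltW.
have xp : `|x - p| < d.
  apply/rV_norm_ltP => // s; rewrite /x addrC addKr scalervE ger0_norm//.
  by rewrite mulr_ge0// ltW.
(* Scale reached after n steps. It is capped at c0, where the growth [hG] was measured;
   subhomogeneity carries that growth to smaller scales. *)
pose c n := Num.min c0 ((1 + h) ^+ n * g).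
have cn0 n : 0 < c n by rewrite lt_min c00 mulr_gt0// exprn_gt0// addr_gt0.
have cn1 n : c n <= c0 by rewrite ge_min lexx.
have xc n : orthant (iter n G x) /\ coord_le (c n *: q) (iter n G x).
  elim: n => [|n [xn0 IH]].
    split=> // s; rewrite /c expr0 mul1r min_r// !scalervE [leRHS]mxE scalervE lerDr.
    exact: p0.
  split; first exact: G_ge0.
  have cq0 : orthant (c n *: q) by apply: orthantZ => //; exact: ltW.
  apply: coord_le_trans (G_homo cq0 IH).
  have -> : c n *: q = (c n / c0) *: (c0 *: q) by rewrite scalerA divfK// gt_eqF.
  have cc : 0 <= c n / c0 <= 1.
    rewrite (ler_pdivrMr _ _ c00) mul1r cn1 andbT.
    exact: divr_ge0 (ltW (cn0 n)) (ltW c00).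
  have cq : orthant (c0 *: q) by apply: orthantZ => //; exact: ltW.
  apply: coord_le_trans (G_star cc cq) => s; rewrite !scalervE.
  have := ler_wpM2l (proj1 (andP cc)) (hG s); rewrite scalervE; apply: le_trans.
  rewrite mulrA; apply: ler_wpM2r => //.
  rewrite (mulrC (1 + h)) mulrA divfK ?gt_eqF// /c.
  have h1 : 1 <= 1 + h by rewrite lerDl ltW.
  rewrite exprSr -mulrA (mulrC (1 + h)) mulrA.
  rewrite minr_pMl ?(le_trans _ h1)// le_min !ge_min lexx orbT andbT.
  by rewrite ler_peMr// ltW.
have [n nP] := exists_expr_ge (c0 / g) h0.
have cn : c n = c0 by rewrite /c min_l// -ler_pdivrMr.
have [_ /(_ t)] := xc n; rewrite cn scalervE => cx.
have /(rV_norm_ltP _ ce)/(_ t) := dP x x0 xp n.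
by rewrite subrvE => /(le_lt_trans (ler_norm _)); lra.
Qed.

End monotone_subhomogeneous.

(** * The diagonal of M - M (I + D M)^-1 *)

Section bilinear_form.
Context {R : realType} {T : nat} (M : 'M[R]_T).
Implicit Types x y z : 'rV[R]_T.

Definition bform x y : R := (x *m M *m y^T) 0 0.

Lemma bformDl x y z : bform (x + y) z = bform x z + bform y z.
Proof. by rewrite /bform !mulmxDl mxE. Qed.

Lemma bformBl x y z : bform (x - y) z = bform x z - bform y z.
Proof. by rewrite /bform !mulmxBl !mxE. Qed.

Lemma bformZl c x z : bform (c *: x) z = c * bform x z.
Proof. by rewrite /bform -!scalemxAl mxE. Qed.

Context (M_sym : M^T = M).

Lemma bformC x y : bform x y = bform y x.
Proof.
rewrite /bform -[in LHS](trmxK (x *m M *m y^T)) mxE.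
by rewrite !trmx_mul trmxK M_sym mulmxA.
Qed.

Lemma bformDr x y z : bform x (y + z) = bform x y + bform x z.
Proof. by rewrite ![bform x _]bformC bformDl. Qed.

Lemma bformBr x y z : bform x (y - z) = bform x y - bform x z.
Proof. by rewrite ![bform x _]bformC bformBl. Qed.

Lemma bformZr c x z : bform x (c *: z) = c * bform x z.
Proof. by rewrite ![bform x _]bformC bformZl. Qed.

End bilinear_form.

Section quadratic_energy.
Context {R : realType} {T : nat} (M : 'M[R]_T) (hM : posdefmx M).
Implicit Types (x y z w h d : 'rV[R]_T) (s t : 'I_T).

Local Notation b := (bform M).
Let e t : 'rV[R]_T := delta_mx 0 t.
Let bC := bformC (proj1 hM).
Let bDr := bformDr (proj1 hM).
Let bBr := bformBr (proj1 hM).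
Let bZr := bformZr (proj1 hM).

Let b_gt0 x : x != 0 -> 0 < b x x.
Proof. exact: (proj2 hM). Qed.

Let b_ge0 x : 0 <= b x x.
Proof.
have [->|x0] := eqVneq x 0; last exact/ltW/b_gt0.
by rewrite /bform !mul0mx mxE.
Qed.

Let b_delta x t : b x (e t) = (x *m M) 0 t.
Proof. by rewrite /bform trmx_delta -colE mxE. Qed.

Let e_neq0 t : e t != 0.
Proof.
apply/eqP => /rowP/(_ t)/eqP; rewrite !mxE !eqxx /=.
by rewrite oner_eq0.
Qed.

Let delta_row t s : (e t *m M) 0 s = M t s.
Proof. by rewrite -rowE mxE. Qed.

Lemma posdefmx_diag_gt0 t : 0 < M t t.
Proof. by rewrite -delta_row -b_delta b_gt0. Qed.

(** (x M)_t is the M-inner product of x and e_t, so this is nonnegativity of the form at x minus its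
    projection on e_t. *)
Let cauchy_schwarz x t : (x *m M) 0 t ^+ 2 <= M t t * b x x.
Proof.
rewrite -b_delta; set c := b x (e t).
have m0 := posdefmx_diag_gt0 t.
have mE : b (e t) (e t) = M t t by rewrite b_delta delta_row.
have := b_ge0 (x - (c / M t t) *: e t).
rewrite bformBl !bBr !bformZl !bZr mE (bC (e t)) -/c.
have -> : b x x - c / M t t * c - (c / M t t * c - c / M t t * (c / M t t * M t t))
   = (M t t * b x x - c ^+ 2) / M t t by field; rewrite gt_eqF.
by rewrite pmulr_lge0 ?invr_gt0// subr_ge0.
Qed.

Definition gain d t : R := (M - M *m invmx (1%:M + diag_mx d *m M)) t t.

Definition energy d t y : R :=
  b (e t - y) (e t - y) + \sum_s d 0 s * (y *m M) 0 s ^+ 2.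

Let bdiag d x y :
  b (x *m M *m diag_mx d) y = \sum_s d 0 s * ((x *m M) 0 s * (y *m M) 0 s).
Proof.
rewrite /bform -mulmxA mxE; apply: eq_bigr => s _.
have -> : (M *m y^T) s 0 = (y *m M) 0 s.
  by rewrite -[in LHS](trmxK (M *m y^T)) mxE trmx_mul trmxK (proj1 hM).
by rewrite mul_mx_diag mxE; ring.
Qed.

(** If v = - v M D, then v M v^T is minus the sum of d_s (v M)_s^2, hence nonpositive, which forces
    v = 0. *)
Lemma unitmx_add1_mul_diag d : orthant d -> 1%:M + M *m diag_mx d \in unitmx.
Proof.
move=> d0; rewrite -row_free_unit -kermx_eq0; apply/eqP/row_matrixP => i.
rewrite row0; set v := row i _.
have : v *m (1%:M + M *m diag_mx d) = 0.
  by rewrite /v -row_mul mulmx_ker row0.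
rewrite mulmxDr mulmx1 mulmxA => /eqP; rewrite addr_eq0 => /eqP vE.
apply/eqP; apply: contraT => /b_gt0; rewrite {1}vE.
rewrite -scaleN1r bformZl bdiag mulN1r oppr_gt0 ltNge sumr_ge0// => s _.
by rewrite mulr_ge0// -expr2 sqr_ge0.
Qed.

(* [gain] is a Schur-complement form, hence the minimum of a quadratic energy
   that is affine and nondecreasing in [d]. *)
Lemma gain_min d t : orthant d -> exists w,
  [/\ w + w *m M *m diag_mx d = e t, gain d t = energy d t w &
      forall y, gain d t <= energy d t y].
Proof.
move=> d0; have U := unitmx_add1_mul_diag d0.
pose w := e t *m invmx (1%:M + M *m diag_mx d).
have wE : w + w *m M *m diag_mx d = e t.
  by rewrite -mulmxA -[X in X + _]mulmx1 -mulmxDr mulmxKV.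
have ew : e t - w = w *m M *m diag_mx d by rewrite -wE addrC addKr.
(* Symmetry of M and D transposes (I + D M)^-1 into (I + M D)^-1, the matrix defining w. *)
have gE : gain d t = b (e t - w) (e t).
  rewrite bformBl !b_delta delta_row /gain mxE; congr (_ + _); rewrite mxE.
  congr (- _); rewrite -[in LHS](trmxK (M *m _)) mxE.
  rewrite trmx_mul trmx_inv linearD /= trmx1 trmx_mul tr_diag_mx (proj1 hM).
  by rewrite /w -mulmxA -rowE [RHS]mxE.
(* Expansion around w: the cross terms cancel because e_t - w = w M D. *)
have E y : energy d t y = gain d t + b (y - w) (y - w)
    + \sum_s d 0 s * ((y - w) *m M) 0 s ^+ 2.
  rewrite /energy.
  have -> : \sum_s d 0 s * (y *m M) 0 s ^+ 2 = b (w *m M *m diag_mx d) w +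
     2 * b (w *m M *m diag_mx d) (y - w) +
     \sum_s d 0 s * ((y - w) *m M) 0 s ^+ 2.
    rewrite !bdiag mulr_sumr -!big_split /=; apply: eq_bigr => s _.
    by rewrite !mulmxBl !mxE; ring.
  rewrite -ew gE; have -> : e t - y = (e t - w) - (y - w).
    by rewrite opprB addrA subrK.
  rewrite bformBl 2!bBr (bC (y - w) (e t - w)).
  have -> : b (e t - w) (e t) = b (e t - w) (e t - w) + b (e t - w) w.
    by rewrite -bDr subrK.
  by ring.
exists w; split => // [|y].
  rewrite E subrr {1}/bform mul0mx mul0mx mxE addr0 big1 ?addr0// => s _.
  by rewrite mxE expr0n mulr0.
rewrite E -addrA lerDl addr_ge0 ?b_ge0 ?sumr_ge0// => s _.
by rewrite mulr_ge0 ?sqr_ge0.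
Qed.

Lemma energy_ge0 d t y : orthant d -> 0 <= energy d t y.
Proof.
move=> d0; rewrite addr_ge0 ?b_ge0// sumr_ge0// => s _.
by rewrite mulr_ge0 ?sqr_ge0.
Qed.

Lemma gain_ge0 d t : orthant d -> 0 <= gain d t.
Proof. by move=> d0; have [w [_ -> _]] := gain_min t d0; exact: energy_ge0. Qed.

Lemma gain_le_diag d t : orthant d -> gain d t <= M t t.
Proof.
move=> d0; have [w [_ _ /(_ 0)]] := gain_min t d0.
rewrite /energy subr0 b_delta delta_row big1 ?addr0// => s _.
by rewrite mul0mx mxE expr0n mulr0.
Qed.

(** At the test vector y = e_t only the part of the energy linear in d survives. *)
Lemma gain_le_linear d t : orthant d ->
  gain d t <= \sum_s d 0 s * M t s ^+ 2.
Proof.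
move=> d0; have [w [_ _ /(_ (e t))]] := gain_min t d0.
rewrite /energy subrr /bform !mul0mx mxE add0r.
by under eq_bigr do rewrite delta_row.
Qed.

Let energyB d d' t y : energy d' t y - energy d t y =
  \sum_s (d' 0 s - d 0 s) * (y *m M) 0 s ^+ 2.
Proof.
rewrite /energy opprD addrACA subrr add0r -sumrB.
by apply: eq_bigr => s _; rewrite mulrBl.
Qed.

(** The minimizer for d' serves as a test vector for d, and the energy is nondecreasing in d. *)
Lemma gain_homo d d' t : orthant d -> coord_le d d' -> gain d t <= gain d' t.
Proof.
move=> d0 dd'; have [w [_ -> _]] := gain_min t (orthant_le d0 dd').
have [_ [_ _ /(_ w) H]] := gain_min t d0; apply: le_trans H _.
rewrite -subr_ge0 energyB sumr_ge0// => s _.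
by rewrite mulr_ge0 ?subr_ge0 ?sqr_ge0.
Qed.

Lemma gain_homo_lt d d' t : orthant d -> (forall s, d 0 s < d' 0 s) ->
  gain d t < gain d' t.
Proof.
move=> d0 dd'; have le : coord_le d d' by move=> s; exact: ltW.
have [w [wE -> _]] := gain_min t (orthant_le d0 le).
have [_ [_ _ /(_ w) H]] := gain_min t d0; apply: le_lt_trans H _.
have term s : 0 <= (d' 0 s - d 0 s) * (w *m M) 0 s ^+ 2.
  by rewrite mulr_ge0 ?subr_ge0 ?sqr_ge0.
rewrite -subr_gt0 energyB lt_def sumr_ge0// andbT psumr_eq0//.
apply/negP => /allP w0.
(* Equality would force w M = 0, hence w = 0, against w + w M D' = e_t. *)
have wM0 : w *m M = 0.
  apply/rowP => s; have := w0 s; rewrite mem_index_enum => /(_ isT).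
  by rewrite mulf_eq0 subr_eq0 gt_eqF//= expf_eq0 /= => /eqP ->; rewrite mxE.
have [w00|/b_gt0] := eqVneq w 0; last by rewrite /bform wM0 mul0mx mxE ltxx.
by move/eqP: wE; rewrite w00 !mul0mx addr0 eq_sym (negbTE (e_neq0 t)).
Qed.

Let energyZ c d t y : energy (c *: d) t y =
  (1 - c) * b (e t - y) (e t - y) + c * energy d t y.
Proof.
rewrite /energy mulrDr addrA -mulrDl subrK mul1r; congr (_ + _).
by rewrite mulr_sumr; apply: eq_bigr => s _; rewrite mxE mulrA.
Qed.

(** For fixed y the energy is affine in d and nonnegative at d = 0, and a minimum of such functions
    is subhomogeneous. *)
Lemma gain_star c d t : 0 <= c <= 1 -> orthant d ->
  c * gain d t <= gain (c *: d) t.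
Proof.
move=> /andP[c0 c1] d0; have [w [_ -> _]] := gain_min t (orthantZ c0 d0).
have [_ [_ _ /(_ w) H]] := gain_min t d0.
by rewrite energyZ ler_wpDl ?ler_wpM2l// mulr_ge0 ?subr_ge0 ?b_ge0.
Qed.

Lemma gain_star_lt c d t : 0 < c < 1 -> orthant d -> 0 < d 0 t ->
  c * gain d t < gain (c *: d) t.
Proof.
move=> /andP[c0 c1] d0 dt; have [w [wE -> _]] := gain_min t (orthantZ (ltW c0) d0).
have [_ [_ _ /(_ w) H]] := gain_min t d0.
rewrite energyZ ltr_pwDl// ?ler_pM2l// mulr_gt0 ?subr_gt0// b_gt0//.
(* Strictness fails only if w = e_t, and then the equation for w gives c d_t M_tt = 0. *)
rewrite subr_eq0; apply/negP => /eqP ew.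
move: wE; rewrite -ew => /eqP; rewrite addrC -subr_eq0 addrK => /eqP/rowP/(_ t).
rewrite mul_mx_diag mxE delta_row [RHS]mxE => /eqP.
by rewrite scalervE !mulf_eq0 (gt_eqF (posdefmx_diag_gt0 t)) (gt_eqF c0) (gt_eqF dt).
Qed.

(** The minimizer at d is a test vector for d', so the slope of its energy in d bounds the
    increase. *)
Lemma gain_lip d t : orthant d -> exists2 K : R, 0 <= K &
  forall d', coord_le d d' ->
    gain d' t <= gain d t + K * \sum_s (d' 0 s - d 0 s).
Proof.
move=> d0; have [w [_ -> _]] := gain_min t d0.
exists (\sum_s (w *m M) 0 s ^+ 2) => [|d' dd'].
  by rewrite sumr_ge0// => s _; exact: sqr_ge0.
have [_ [_ _ /(_ w) H]] := gain_min t (orthant_le d0 dd').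
apply: le_trans H _; rewrite -lerBlDl energyB mulr_sumr ler_sum// => s _.
rewrite mulrC ler_wpM2r ?subr_ge0// (bigD1 s)//= lerDl sumr_ge0// => i _.
exact: sqr_ge0.
Qed.

(* With z = e_t - y, apply (a - c)^2 >= (1 - r) a^2 - (1/r - 1) c^2 to
   (y M)_s = M_ts - (z M)_s and absorb the c^2 terms into z M z^T. *)
Lemma gain_ge_linear r d t : 0 < r <= 1 -> orthant d ->
  \sum_s d 0 s * M s s <= r ->
  (1 - r) * \sum_s d 0 s * M t s ^+ 2 <= gain d t.
Proof.
move=> /andP[r0 r1] d0 dr; have [y [_ -> _]] := gain_min t d0.
rewrite /energy; set z := e t - y.
have yE s : (y *m M) 0 s = M t s - (z *m M) 0 s.
  by rewrite /z mulmxBl -delta_row !mxE opprB addrC subrK.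
have rV : 0 <= r^-1 - 1 by rewrite subr_ge0 invf_ge1.
apply: (@le_trans _ _ (b z z + \sum_s d 0 s *
   ((1 - r) * M t s ^+ 2 - (r^-1 - 1) * (M s s * b z z)))); last first.
  rewrite lerD2l ler_sum// => s _; rewrite ler_wpM2l// yE.
  apply: (@le_trans _ _ ((1 - r) * M t s ^+ 2 - (r^-1 - 1) * (z *m M) 0 s ^+ 2)).
    by rewrite lerD2l lerN2 ler_wpM2l// cauchy_schwarz.
  rewrite -subr_ge0; set c := (z *m M) 0 s.
  have -> : (M t s - c) ^+ 2 - ((1 - r) * M t s ^+ 2 - (r^-1 - 1) * c ^+ 2) =
    r * (M t s - c / r) ^+ 2 by field; rewrite gt_eqF.
  by rewrite mulr_ge0 ?sqr_ge0// ltW.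
have -> : \sum_s d 0 s * ((1 - r) * M t s ^+ 2 - (r^-1 - 1) * (M s s * b z z)) =
  (1 - r) * (\sum_s d 0 s * M t s ^+ 2)
   - (r^-1 - 1) * b z z * \sum_s d 0 s * M s s.
  by rewrite !mulr_sumr -sumrB; apply: eq_bigr => s _; ring.
(* Since the sum of d_s M_ss is at most r, the absorbed terms amount to at most (1/r - 1) r = 1 - r
   times z M z^T. *)
rewrite addrCA lerDl subr_ge0.
apply: (@le_trans _ _ ((r^-1 - 1) * b z z * r)).
  by rewrite ler_wpM2l// mulr_ge0 ?b_ge0.
rewrite mulrAC mulrBl mulVf ?gt_eqF// mul1r ler_piMl ?b_ge0//; lra.
Qed.

End quadratic_energy.

(** * The spectral threshold *)

Section rayleigh.
Context {R : realType} {n : nat}.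
Implicit Types (A : 'M[R]_n) (x y : 'rV[R]_n).

Lemma quadratic_formE A x :
  (x *m A *m x^T) 0 0 = \sum_i \sum_j x 0 i * A i j * x 0 j.
Proof.
rewrite mxE exchange_big /=; apply: eq_bigr => j _.
by rewrite !mxE mulr_suml.
Qed.

Lemma rV_sqnormE x : (x *m x^T) 0 0 = \sum_i x 0 i ^+ 2.
Proof. by rewrite mxE; apply: eq_bigr => i _; rewrite mxE expr2. Qed.

Lemma rV_sqnorm_gt0 x : x != 0 -> 0 < (x *m x^T) 0 0.
Proof.
move=> x0; rewrite rV_sqnormE lt_def sumr_ge0 ?andbT => [|i _]; last exact: sqr_ge0.
apply: contra x0; rewrite psumr_eq0 => [/allP H|i _]; last exact: sqr_ge0.
apply/eqP/rowP => i; rewrite mxE; apply/eqP.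
by have := H i; rewrite mem_index_enum sqrf_eq0 => /(_ isT).
Qed.

Lemma continuous_quadratic_form A :
  continuous (fun x => \sum_i \sum_j x 0 i * A i j * x 0 j).
Proof.
apply: continuous_big; first exact: add_continuous.
move=> i _; apply: continuous_big; first exact: add_continuous.
move=> j _ x.
have ci := @coord_continuous R 1 n 0 i x.
have cj := @coord_continuous R 1 n 0 j x.
exact: (cvgM (cvgM ci (cvg_cst (A i j))) cj).
Qed.

Lemma sphere_compact : compact [set x : 'rV[R]_n | \sum_i x 0 i ^+ 2 = 1].
Proof.
apply: bounded_closed_compact.
  exists 1; split=> // M M1 x /= x1; apply/ltW/rV_norm_ltP => [|t].
    exact: lt_trans M1.
  apply: le_lt_trans M1; rewrite -(@expr_le1 _ 2)// real_normK ?num_real//.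
  rewrite -x1 (bigD1 t)//= lerDl sumr_ge0// => i _; exact: sqr_ge0.
apply: (@preimage_closed _ _ (fun x : 'rV[R]_n => \sum_i x 0 i ^+ 2) [set 1]).
  move=> x _; move: x; apply: continuous_big; first exact: add_continuous.
  move=> i _ x; have ci := @coord_continuous R 1 n 0 i x.
  exact: (cvgM ci ci).
exact: closed_eq.
Qed.

(* A unit maximizer c of the quadratic form with value mu is an eigenvector:
   otherwise moving from c along - c (mu I - A) would exceed mu. *)
Lemma rayleigh_le1 A : A^T = A -> (forall a, eigenvalue A a -> a <= 1) ->
  forall x, (x *m A *m x^T) 0 0 <= (x *m x^T) 0 0.
Proof.
move=> AT eigA x; have [->|x0] := eqVneq x 0.
  by rewrite !mul0mx mxE.
pose f y := \sum_i \sum_j y 0 i * A i j * y 0 j.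
have fZ k y : f (k *: y) = k ^+ 2 * f y.
  rewrite /f mulr_sumr; apply: eq_bigr => i _; rewrite mulr_sumr.
  by apply: eq_bigr => j _; rewrite !mxE; ring.
have sZ k y : ((k *: y) *m (k *: y)^T) 0 0 = k ^+ 2 * (y *m y^T) 0 0.
  rewrite !rV_sqnormE mulr_sumr; apply: eq_bigr => i _.
  by rewrite mxE exprMn.
have unit y : y != 0 ->
    \sum_i ((Num.sqrt ((y *m y^T) 0 0))^-1 *: y) 0 i ^+ 2 = 1.
  move=> y0; rewrite -rV_sqnormE sZ exprVn sqr_sqrtr ?mulVf//.
    by rewrite gt_eqF// rV_sqnorm_gt0.
  exact/ltW/rV_sqnorm_gt0.
have [||c /[!inE] /= c1 cmax] := @EVT_max_rV R n f _ _ sphere_compact.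
- by exists ((Num.sqrt ((x *m x^T) 0 0))^-1 *: x); exact: unit.
- exact/continuous_subspaceT/continuous_quadratic_form.
set mu := f c in cmax.
pose B : 'M[R]_n := mu%:M - A.
have BT : B^T = B by rewrite /B linearB /= tr_scalar_mx AT.
have Bq y : (y *m B *m y^T) 0 0 = mu * (y *m y^T) 0 0 - f y.
  by rewrite /B mulmxBr mulmxBl mul_mx_scalar -scalemxAl [LHS]mxE
     [X in _ + X]mxE quadratic_formE [X in X - _]mxE.
have B0 y : 0 <= (y *m B *m y^T) 0 0.
  have [->|y0] := eqVneq y 0; first by rewrite !mul0mx mxE.
  rewrite Bq subr_ge0; have yp := rV_sqnorm_gt0 y0.
  have := cmax ((Num.sqrt ((y *m y^T) 0 0))^-1 *: y).
  rewrite inE => /(_ (unit y y0)).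
  by rewrite fZ exprVn (sqr_sqrtr (ltW yp)) mulrC ler_pdivrMr.
have Bc : (c *m B *m c^T) 0 0 = 0.
  by rewrite Bq rV_sqnormE c1 mulr1 subrr.
pose h := c *m B.
have cB0 : h = 0.
  apply/eqP; apply: contraT => h0.
  have p := rV_sqnorm_gt0 h0; set bb := (h *m h^T) 0 0 in p.
  set g := (h *m B *m h^T) 0 0; have g0 : 0 <= g by exact: B0.
  have hBc : (h *m B *m c^T) 0 0 = bb.
    rewrite /bb /h -[in LHS](trmxK (_ *m c^T)) mxE !trmx_mul trmxK BT.
    by rewrite !mulmxA.
  (* With step k = bb / (g + 1), the form at c - k h equals - 2 k bb + k^2 g = - bb^2 (g + 2) / (g +
     1)^2 < 0. The 1 in g + 1 covers g = 0. *)
  have := B0 (c - (bb / (g + 1)) *: h); rewrite -/(bform B _ _).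
  rewrite bformBl !(bformBr BT) !bformZl !(bformZr BT) (bformC BT c).
  rewrite {1}/bform Bc [bform B h c]hBc -[bform B h h]/g => H.
  have g1 : 0 < g + 1 by rewrite ltr_wpDl.
  have : bb ^+ 2 * (g + 2) / (g + 1) ^+ 2 <= 0.
    suff -> : bb ^+ 2 * (g + 2) / (g + 1) ^+ 2 = - (0 - bb / (g + 1) * bb -
      (bb / (g + 1) * bb - bb / (g + 1) * (bb / (g + 1) * g))) by rewrite oppr_le0.
    by field; rewrite gt_eqF.
  by rewrite leNgt divr_gt0 ?mulr_gt0 ?exprn_gt0// ltr_wpDl.
have c0 : c != 0.
  apply/eqP => c0; have := c1; rewrite c0 big1 => [/eqP|i _].
    by rewrite eq_sym oner_eq0.
  by rewrite mxE expr0n.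
have mu1 : mu <= 1.
  apply: eigA; apply/eigenvalueP; exists c => //.
  move/eqP: cB0; rewrite /h /B mulmxBr mul_mx_scalar subr_eq0 => /eqP ->//.
have fE : f x = (x *m A *m x^T) 0 0 by rewrite quadratic_formE.
have := B0 x; rewrite Bq fE subr_ge0 => /le_trans; apply.
by rewrite ler_piMl// ltW// rV_sqnorm_gt0.
Qed.

End rayleigh.

(** * The map G, its greatest fixed point and the matrix R *)

Section overlap_map.
Context {R : realType} {T : nat} (lambda alpha : 'I_T -> R) (C : 'M[R]_T).
Context (hlambda : forall t, 0 < lambda t) (halpha : forall t, 0 < alpha t).
Context (hC : posdefmx C).
Implicit Types (x y : 'rV[R]_T) (s t : 'I_T).

Local Notation M := (Mmx lambda C).
Local Notation Rm := (Rmx alpha lambda C).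

Lemma MmxE s t : M s t = C s t * Num.sqrt (lambda s) * Num.sqrt (lambda t).
Proof. by rewrite mxE /noise_sd -invfM invrK mulrA. Qed.

Lemma Mmx_sqr s t : M s t ^+ 2 = C s t ^+ 2 * lambda s * lambda t.
Proof. by rewrite MmxE !exprMn !sqr_sqrtr// ltW. Qed.

Lemma Mmx_posdef : posdefmx M.
Proof.
pose S : 'M[R]_T := diag_mx (\row_t Num.sqrt (lambda t)).
have ME : M = S *m C *m S.
  apply/matrixP => s t; rewrite MmxE /S mul_mx_diag mxE mul_diag_mx !mxE.
  by rewrite (mulrC (Num.sqrt _)).
split; first by rewrite ME !trmx_mul (proj1 hC) tr_diag_mx mulmxA.
move=> x x0; have -> : x *m M *m x^T = (x *m S) *m C *m (x *m S)^T.
  by rewrite ME trmx_mul tr_diag_mx !mulmxA.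
apply: (proj2 hC); apply: contra x0 => /eqP/rowP xS.
apply/eqP/rowP => t; have := xS t; rewrite /S mul_mx_diag !mxE => /eqP.
by rewrite mulf_eq0 sqrtr_eq0 leNgt hlambda orbF => /eqP.
Qed.
Let hM := Mmx_posdef.

(** The diagonal of D as a function of q_u, so that G is [gain] composed with this map. *)
Definition overlap_load x : 'rV[R]_T := \row_t (alpha t * Foverlap (x 0 t)).
Local Notation load := overlap_load.

Lemma GmapE x t : Gmap alpha lambda C x 0 t = gain M (load x) t.
Proof.
have E : Dmx alpha (qv_of x) = diag_mx (load x).
  by congr diag_mx; apply/rowP => s; rewrite !mxE.
by rewrite /Gmap /qu_of [LHS]mxE E.
Qed.

(* An abstract G keeps conversion from unfolding [Gmap]. *)
Context (G : 'rV[R]_T -> 'rV[R]_T) (GE : forall x t, G x 0 t = gain M (load x) t).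

Let loadE x t : load x 0 t = alpha t * Foverlap (x 0 t).
Proof. by rewrite mxE. Qed.

Let load_ge0 x : orthant x -> orthant (load x).
Proof. by move=> x0 t; rewrite loadE mulr_ge0 ?Foverlap_ge0// ltW. Qed.

Let load_homo x y : orthant x -> coord_le x y -> coord_le (load x) (load y).
Proof. by move=> x0 xy t; rewrite !loadE (ler_pM2l (halpha t)); exact: Foverlap_le. Qed.

Let load_star c x : 0 <= c <= 1 -> orthant x ->
  coord_le (c *: load x) (load (c *: x)).
Proof.
move=> c01 x0 t; rewrite scalervE !loadE mulrCA (ler_pM2l (halpha t)) scalervE.
exact: Foverlap_star.
Qed.

Lemma Gmap_ge0 x : orthant x -> orthant (G x).
Proof. by move=> x0 t; rewrite GE; exact: (gain_ge0 hM t (load_ge0 x0)). Qed.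

Lemma Gmap_homo x y : orthant x -> coord_le x y -> coord_le (G x) (G y).
Proof.
move=> x0 xy t; rewrite (GE x t) (GE y t).
exact: (gain_homo hM t (load_ge0 x0) (load_homo x0 xy)).
Qed.

Lemma Gmap_homo_lt x y : orthant x ->
  (forall t, x 0 t < y 0 t) -> forall t, G x 0 t < G y 0 t.
Proof.
move=> x0 xy t; rewrite (GE x t) (GE y t).
apply: (gain_homo_lt hM t (load_ge0 x0)) => s.
by rewrite !loadE (ltr_pM2l (halpha s)); exact: Foverlap_lt.
Qed.

Lemma Gmap_star c x : 0 <= c <= 1 -> orthant x ->
  coord_le (c *: G x) (G (c *: x)).
Proof.
move=> /[dup] c01 /andP[c0 _] x0 t; rewrite scalervE (GE x t) (GE (c *: x) t).
apply: (le_trans (gain_star hM t c01 (load_ge0 x0))).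
exact: (gain_homo hM t (orthantZ c0 (load_ge0 x0)) (load_star c01 x0)).
Qed.

Lemma Gmap_star_lt c x t : 0 < c < 1 -> orthant x -> 0 < x 0 t ->
  c * G x 0 t < G (c *: x) 0 t.
Proof.
move=> /[dup] c01 /andP[c0 c1] x0 xt; rewrite (GE x t) (GE (c *: x) t).
have lt0 : 0 < load x 0 t by rewrite loadE mulr_gt0// Foverlap_gt0.
apply: (lt_le_trans (gain_star_lt hM c01 (load_ge0 x0) lt0)).
have c01' : 0 <= c <= 1 by rewrite !ltW.
exact: (gain_homo hM t (orthantZ (ltW c0) (load_ge0 x0)) (load_star c01' x0)).
Qed.

Lemma Gmap_ub x : orthant x -> coord_le (G x) (\row_t M t t).
Proof.
move=> x0 t; rewrite (GE x t) [leRHS]mxE.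
exact: (gain_le_diag hM t (load_ge0 x0)).
Qed.

Lemma Gmap_lip x : orthant x -> exists2 K : R, 0 <= K &
  forall y, coord_le x y ->
    forall t, G y 0 t <= G x 0 t + K * \sum_s (y 0 s - x 0 s).
Proof.
move=> x0.
have H t : exists K : R, 0 <= K /\ forall d, coord_le (load x) d ->
    gain M d t <= gain M (load x) t + K * \sum_s (d 0 s - load x 0 s).
  by have [K K0 KP] := gain_lip hM t (load_ge0 x0); exists K.
have [f fP] := choice H.
have A0 : 0 <= \sum_s alpha s by rewrite sumr_ge0// => s _; exact: ltW.
have f0 : 0 <= \sum_t f t by rewrite sumr_ge0// => t _; case: (fP t).
exists ((\sum_t f t) * \sum_s alpha s) => [|y xy t]; first exact: mulr_ge0.
have [ft0 /(_ _ (load_homo x0 xy))] := fP t.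
rewrite -(GE x t) -(GE y t) => /le_trans; apply; rewrite lerD2l -mulrA.
have xy0 s : 0 <= y 0 s - x 0 s by rewrite subr_ge0.
have l0 : 0 <= \sum_s (load y 0 s - load x 0 s).
  by rewrite sumr_ge0// => s _; rewrite subr_ge0; exact: load_homo.
apply: (@le_trans _ _ ((\sum_t f t) * \sum_s (load y 0 s - load x 0 s))).
  rewrite ler_wpM2r// (bigD1 t)//= lerDl sumr_ge0// => s _.
  by case: (fP s).
rewrite ler_wpM2l// mulr_sumr ler_sum// => s _.
apply: (@le_trans _ _ (alpha s * (y 0 s - x 0 s))).
  rewrite !loadE -mulrBr ler_pM2l// lerBlDl.
  by have := Foverlap_lip (x0 s) (xy0 s); rewrite addrC subrK.
rewrite ler_wpM2r// (bigD1 s)//= lerDl sumr_ge0// => i _; exact: ltW.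
Qed.

Definition overlap_u : 'rV[R]_T := top_fixpoint G (\row_t M t t).
Local Notation q := overlap_u.

Lemma overlap_u_ge0 : orthant q.
Proof.
apply: top_fixpoint_ge0; [exact: Gmap_ge0|exact: Gmap_ub].
Qed.

Lemma overlap_uP : G q = q.
Proof.
apply: top_fixpointP; [exact: Gmap_ge0|exact: Gmap_homo|exact: Gmap_ub|].
exact: Gmap_lip.
Qed.

Lemma overlap_u_stable : lyapunov_stable (@orthant R T) G q.
Proof.
apply: top_fixpoint_stable; [exact: Gmap_ge0|exact: Gmap_homo
  |exact: Gmap_homo_lt|exact: Gmap_star|exact: Gmap_ub|exact: Gmap_lip].
Qed.

Lemma overlap_u_unique p : orthant p -> G p = p ->
  lyapunov_stable (@orthant R T) G p -> p = q.
Proof.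
apply: stable_fixpoint_unique; [exact: Gmap_ge0|exact: Gmap_homo
  |exact: Gmap_star|exact: Gmap_star_lt|exact: Gmap_ub|exact: Gmap_lip].
Qed.

Lemma subsolution_le_overlap_u x : orthant x -> coord_le x (G x) ->
  coord_le x q.
Proof.
apply: subsolution_le_top_fixpoint; [exact: Gmap_homo|exact: Gmap_ub].
Qed.

(** With A = diag alpha and N the entrywise square of M, R = A^(1/2) N A^(1/2), which is similar to
    the linearization N A of G at 0. *)
Lemma RmxE s t : Rm s t =
  Num.sqrt (alpha s) * Num.sqrt (alpha t) * M t s ^+ 2.
Proof.
rewrite mxE Mmx_sqr sqrtrM ?ltW//.
have -> : C t s = C s t by rewrite -[in LHS](proj1 hC) mxE.
by ring.
Qed.

Lemma Rmx_sym : Rm^T = Rm.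
Proof.
apply/matrixP => s t; rewrite mxE !RmxE (mulrC (Num.sqrt (alpha t))).
by rewrite -[in LHS](proj1 hM) mxE.
Qed.

Lemma Gmap_le_linear x t : orthant x ->
  G x 0 t <= \sum_s alpha s * Foverlap (x 0 s) * M t s ^+ 2.
Proof.
move=> x0; rewrite (GE x t); apply: (le_trans (gain_le_linear hM t (load_ge0 x0))).
by under eq_bigr do rewrite loadE.
Qed.

Lemma Gmap_le_linear_lt x t : orthant x -> 0 < x 0 t ->
  G x 0 t < \sum_s alpha s * x 0 s * M t s ^+ 2.
Proof.
move=> x0 xt; apply: (le_lt_trans (Gmap_le_linear t x0)).
rewrite (bigD1 t)//= [ltRHS](bigD1 t)//=; apply: ltr_leD.
  rewrite ltr_pM2r ?exprn_gt0 ?posdefmx_diag_gt0//.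
  by rewrite ltr_pM2l// Foverlap_lt_id.
apply: ler_sum => s _; rewrite ler_wpM2r ?sqr_ge0//.
by rewrite ler_pM2l// Foverlap_le_id.
Qed.

Lemma overlap_u_eq0 : (forall a, eigenvalue Rm a -> a <= 1) ->
  forall t, q 0 t = 0.
Proof.
move=> eigR t; apply/eqP; apply: contraT => qt.
have q0 := overlap_u_ge0.
have {}qt : 0 < q 0 t by rewrite lt_def qt q0.
pose v : 'rV[R]_T := \row_s (Num.sqrt (alpha s) * q 0 s).
have sa s : Num.sqrt (alpha s) * Num.sqrt (alpha s) = alpha s.
  by rewrite -expr2 sqr_sqrtr// ltW.
have vE0 s : v 0 s = Num.sqrt (alpha s) * q 0 s by rewrite mxE.
(* v_s^2 equals alpha_s q_s G(q)_s, and [row s] replaces G by its linearization; the inequality is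
   strict wherever q_s > 0. *)
pose row s := alpha s * q 0 s * \sum_r alpha r * q 0 r * M s r ^+ 2.
have := rayleigh_le1 Rmx_sym eigR v.
rewrite quadratic_formE rV_sqnormE leNgt => /negP; case.
have -> : \sum_i \sum_j v 0 i * Rm i j * v 0 j = \sum_s row s.
  apply: eq_bigr => s _; rewrite /row mulr_sumr; apply: eq_bigr => r _.
  rewrite RmxE -[M r s](_ : M s r = _); last first.
    by rewrite -[in LHS](proj1 hM) mxE.
  rewrite !vE0 -[in RHS](sa s) -[alpha r in RHS]sa; ring.
have vE s : v 0 s ^+ 2 = alpha s * q 0 s * q 0 s.
  by rewrite vE0 -[in RHS](sa s); ring.
have le s : v 0 s ^+ 2 <= row s.
  rewrite vE /row; have [qs|] := ltP 0 (q 0 s).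
    by rewrite ler_pM2l ?mulr_gt0// -[in leLHS]overlap_uP ltW// Gmap_le_linear_lt.
  move=> qs; have -> : q 0 s = 0 by apply/eqP; rewrite eq_le qs q0.
  by rewrite !(mulr0, mul0r).
rewrite (bigD1 t)//= [ltRHS](bigD1 t)//=; apply: ltr_leD; last by apply: ler_sum.
rewrite vE /row ltr_pM2l ?mulr_gt0// -[in ltLHS]overlap_uP.
exact: Gmap_le_linear_lt.
Qed.

(* The entrywise modulus w of an eigenvector satisfies a w <= w R, so a small
   multiple of (w_t / sqrt alpha_t)_t is a nonzero subsolution x <= G x. *)
Lemma eigenvalue_gt1_overlap_u a : eigenvalue Rm a -> 1 < a ->
  exists t, 0 < q 0 t.
Proof.
move=> /eigenvalueP[v vR v0] a1.
have a0 : 0 < a by exact: lt_trans a1.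
(* The margin [h] pays for two losses: 1 - h/8 from [gain_ge_linear] and 1 - h/2 from F x >= x (1 -
   4 x) at x <= h/8. Their product is at least 1 - h = 1/a. *)
pose h := 1 - a^-1.
have h0 : 0 < h by rewrite subr_gt0 invf_lt1.
have h1 : h < 1 by rewrite gtrBl invr_gt0.
pose z t := `|v 0 t| / Num.sqrt (alpha t).
have sa0 t : 0 < Num.sqrt (alpha t) by rewrite sqrtr_gt0.
have sa s : Num.sqrt (alpha s) * Num.sqrt (alpha s) = alpha s.
  by rewrite -expr2 sqr_sqrtr// ltW.
have z0 t : 0 <= z t by rewrite divr_ge0// ltW.
have mm0 t : 0 < M t t by exact: posdefmx_diag_gt0.
have az0 t : 0 <= alpha t * z t * M t t.
  exact: mulr_ge0 (mulr_ge0 (ltW (halpha t)) (z0 t)) (ltW (mm0 t)).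
pose S := \sum_s z s + \sum_s alpha s * z s * M s s.
have S0 : 0 <= S by rewrite addr_ge0 ?sumr_ge0.
have S1 : 0 < 1 + S by rewrite ltr_pwDl.
(* One scale makes both the coordinates of x and the sum of load_s M_ss at most h/8. *)
pose g := h / 8 / (1 + S).
have g0 : 0 < g by rewrite !divr_gt0.
have gS : g * S <= h / 8.
  rewrite /g mulrAC ler_pdivrMr// ler_wpM2l ?divr_ge0 ?ltW//; lra.
pose x : 'rV[R]_T := \row_t (g * z t).
have xE t : x 0 t = g * z t by rewrite mxE.
have x0 : orthant x by move=> t; rewrite xE mulr_ge0// ltW.
have xh t : x 0 t <= h / 8.
  rewrite xE; apply: le_trans gS; rewrite ler_pM2l// /S (bigD1 t)//= -addrA lerDl.
  by rewrite addr_ge0// sumr_ge0.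
(* The triangle inequality in the eigenvector equation, divided by sqrt alpha_t. *)
have zle t : a * z t <= \sum_s alpha s * z s * M t s ^+ 2.
  have /rowP/(_ t) := vR; rewrite [RHS]mxE mxE => E.
  have : a * `|v 0 t| <= \sum_s `|v 0 s| * Rm s t.
    rewrite -[X in X * _]gtr0_norm// -normrM -E.
    apply: le_trans (ler_norm_sum _ _ _) _; apply: ler_sum => s _.
    rewrite normrM (ger0_norm (x := Rm s t))// RmxE.
    exact: mulr_ge0 (mulr_ge0 (ltW (sa0 s)) (ltW (sa0 t))) (sqr_ge0 _).
  rewrite -(ler_pM2r (x := (Num.sqrt (alpha t))^-1)) ?invr_gt0// -mulrA.
  move=> /le_trans; apply; rewrite mulr_suml; apply: ler_sum => s _.
  have -> : alpha s * z s = Num.sqrt (alpha s) * `|v 0 s|.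
    by rewrite /z -[X in X * _]sa; field; rewrite gt_eqF.
  rewrite RmxE le_eqVlt; apply/orP; left; apply/eqP.
  by field; rewrite !gt_eqF.
have xG : coord_le x (G x).
  move=> t; rewrite (GE x t).
  have r01 : 0 < h / 8 <= 1 by apply/andP; split; lra.
  have lx s : load x 0 s <= alpha s * x 0 s.
    by rewrite loadE ler_pM2l// Foverlap_le_id.
  have loadS : \sum_s load x 0 s * M s s <= h / 8.
    apply: le_trans gS; apply: (@le_trans _ _ (g * \sum_s alpha s * z s * M s s)).
      rewrite mulr_sumr; apply: ler_sum => s _.
      have := ler_wpM2r (ltW (mm0 s)) (lx s); rewrite xE => /le_trans; apply.
      by rewrite le_eqVlt; apply/orP; left; apply/eqP; ring.
    by rewrite ler_pM2l// /S lerDr sumr_ge0.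
  apply: le_trans (gain_ge_linear hM t r01 (load_ge0 x0) loadS).
  have low : (1 - h / 2) * \sum_s alpha s * x 0 s * M t s ^+ 2 <=
      \sum_s load x 0 s * M t s ^+ 2.
    rewrite mulr_sumr; apply: ler_sum => s _; rewrite mulrA ler_wpM2r ?sqr_ge0//.
    rewrite loadE mulrCA ler_pM2l//.
    have xs := x0 s; have xhs := xh s.
    apply: le_trans (Foverlap_ge_quadratic _); last by rewrite xs/=; lra.
    by rewrite mulrC ler_wpM2l//; lra.
  have h81 : 0 <= 1 - h / 8 by lra.
  apply: le_trans (ler_wpM2l h81 low); rewrite mulrA.
  have -> : \sum_s alpha s * x 0 s * M t s ^+ 2 =
      g * \sum_s alpha s * z s * M t s ^+ 2.
    by rewrite mulr_sumr; apply: eq_bigr => s _; rewrite xE; ring.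
  rewrite xE [leRHS]mulrCA ler_pM2l//.
  have hh : a^-1 <= (1 - h / 8) * (1 - h / 2).
    have -> : a^-1 = 1 - h by rewrite /h subKr.
    by have := sqr_ge0 h; nra.
  have pp : 0 <= (1 - h / 8) * (1 - h / 2) by apply: le_trans hh; rewrite invr_ge0 ltW.
  apply: le_trans (ler_wpM2l pp (zle t)).
  have := ler_wpM2r (mulr_ge0 (ltW a0) (z0 t)) hh.
  by rewrite mulKf ?gt_eqF.
have [t vt] : exists t, v 0 t != 0.
  apply/existsP; apply: contraR v0 => /existsPn H.
  by apply/eqP/rowP => t; rewrite mxE; apply/eqP/negPn/H.
exists t; apply: lt_le_trans (subsolution_le_overlap_u x0 xG t).
by rewrite xE !mulr_gt0 ?normr_gt0 ?invr_gt0.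
Qed.

End overlap_map.

(** * Uniqueness of the overlaps and the threshold *)

Lemma is_overlapsP (R : realType) (T : nat) (lambda alpha : 'I_T -> R)
    (C : 'M[R]_T) (hlambda : forall t, 0 < lambda t)
    (halpha : forall t, 0 < alpha t) (hC : posdefmx C) p :
  let q := overlap_u lambda C (Gmap alpha lambda C) in
  is_overlaps alpha lambda C p <-> p = (q, qv_of q).
Proof.
have GE := @GmapE R T lambda alpha C.
case: p => u v; split=> [[[/= u0 v0] uE vE st]|->].
  rewrite /= in uE vE st; subst v.
  by rewrite (overlap_u_unique hlambda halpha hC GE u0 (esym uE) st).
have q0 := overlap_u_ge0 hlambda halpha hC GE.
split => /=; last exact: (overlap_u_stable hlambda halpha hC GE).
- by split=> // t; rewrite mxE Foverlap_ge0.
- exact: esym (overlap_uP hlambda halpha hC GE).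
- by [].
Qed.

Theorem mainTheorem3 (R : realType) (T : nat) (hT : (1 <= T)%N)
    (lambda alpha : 'I_T -> R) (C : 'M[R]_T)
    (hlambda : forall t, 0 < lambda t) (halpha : forall t, 0 < alpha t)
    (hC : posdefmx C) (hdiag : forall t, C t t = 1) :
  (exists! q : 'rV[R]_T * 'rV[R]_T, is_overlaps alpha lambda C q) /\
  (forall q : 'rV[R]_T * 'rV[R]_T, is_overlaps alpha lambda C q ->
    ((forall t, impossible q t) <->
     (forall a : R, eigenvalue (Rmx alpha lambda C) a -> a <= 1))).
Proof.
have GE := @GmapE R T lambda alpha C.
have ovP p := is_overlapsP hlambda halpha hC p.
set q := overlap_u _ _ _ in ovP.
split.
  exists (q, qv_of q); split=> [|p /ovP ->//]; exact/ovP.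
move=> p /ovP ->; split=> [imp a eig|eig t]; last first.
  exact: (overlap_u_eq0 hlambda halpha hC GE).
rewrite leNgt; apply/negP => a1.
have [t] := eigenvalue_gt1_overlap_u hlambda halpha hC GE eig a1.
by rewrite (imp t : overlap_u _ _ _ 0 t = 0) ltxx.
Qed.
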